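(* Let $L\ge2$, $D\ge1$, and consider depth-$L$ linear convolutional networks with parameters $\mathbf{u}=[\mathbf{u}_l]_{l=1}^L$, $\mathbf{u}_l\in\mathbb{R}^D$, computing $f_{\mathbf{u}}(\mathbf{x})=\big((((\mathbf{x}\star\mathbf{u}_1)\star\mathbf{u}_2)\cdots)\star\mathbf{u}_{L-1}\big)^\top\mathbf{u}_L=\langle\mathbf{x},\mathcal{P}_{conv}(\mathbf{u})\rangle$. For almost all linearly separable datasets $\{(\mathbf{x}_n,y_n)\}_{n=1}^N\subset\mathbb{R}^D\times\{-1,1\}$, almost all initializations $\mathbf{u}^{(0)}$, and any step sizes $\{\eta_t\}$ with $\eta_t$ smaller than the local Lipschitz constant at $\mathbf{u}^{(t)}$, consider gradient descent $\mathbf{u}^{(t+1)}=\mathbf{u}^{(t)}-\eta_t\nabla_{\mathbf{u}}\mathcal{L}_{\mathcal{P}_{conv}}(\mathbf{u}^{(t)})$ with $\mathcal{L}_{\mathcal{P}_{conv}}(\mathbf{u})=\sum_n\exp(-y_n\langle\mathbf{x}_n,\mathcal{P}_{conv}(\mathbf{u})\rangle)$; let $\mathbf{w}^{(t)}=\mathcal{P}_{conv}(\mathbf{u}^{(t)})$ and $\mathcal{L}(\mathbf{w})=\sum_n\exp(-y_n\langle\mathbf{x}_n,\mathbf{w}\rangle)$. Suppose (a) $\mathcal{L}_{\mathcal{P}_{conv}}(\mathbf{u}^{(t)})\to0$; (b) $\mathbf{u}^{(t)}$ converges in direction, yielding $\bar{\mathbf{w}}^\infty=\lim_t\mathbf{w}^{(t)}/\|\mathbf{w}^{(t)}\|$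 with $\min_ny_n\langle\mathbf{x}_n,\bar{\mathbf{w}}^\infty\rangle>0$; (c) for every $d$, $e^{\mathrm{i}\phi_{\hat{\mathbf{w}}^{(t)}[d]}}$ converges; (d) $\nabla_{\mathbf{w}}\mathcal{L}(\mathbf{w}^{(t)})$ converges in direction. Then $\bar{\mathbf{w}}^\infty$ is a positive scaling of a first order stationary point of $$\min_{\mathbf{w}}\|\hat{\mathbf{w}}\|_{2/L}\ \text{ s.t. }\ \forall n,\ y_n\langle\mathbf{w},\mathbf{x}_n\rangle\ge1.$$
   Context: Circular convolution: $(\mathbf{h}\star\mathbf{u})[d]=\frac{1}{\sqrt D}\sum_{k=0}^{D-1}\mathbf{u}[k]\mathbf{h}[(d+k)\bmod D]$ (indices $0,\dots,D-1$). DFT: $\hat{\mathbf{w}}[d]=\frac{1}{\sqrt D}\sum_{p}\mathbf{w}[p]e^{-2\pi\mathrm{i}pd/D}$; complex numbers are written $z=|z|e^{\mathrm{i}\phi_z}$, $\phi_z\in[0,2\pi)$. For $p>0$, $\|\mathbf{z}\|_p=(\sum_i|\mathbf{z}[i]|^p)^{1/p}$. With $p=2/L$, a first order stationary point of the problem is a feasible $\mathbf{w}$ for which there exist $\alpha_n\ge0$ with $\alpha_n=0$ whenever $y_n\langle\mathbf{x}_n,\mathbf{w}\rangle>1$, and $\sum_n\alpha_ny_n\hat{\mathbf{x}}_n\in\partial^\circ\|\hat{\mathbf{w}}\|_p$, where $\partial^\circ$ is the Clarke (local) subdifferential; concretely, for $p=1$, $\partial^\circ\|\hat{\mathbf{w}}\|_1=\{\hat{\mathbf{z}}:\forall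 d,\ |\hat{\mathbf{z}}[d]|\le1,\ \hat{\mathbf{w}}[d]\neq0\Rightarrow\hat{\mathbf{z}}[d]=e^{\mathrm{i}\phi_{\hat{\mathbf{w}}[d]}}\}$, and for $p<1$, $\partial^\circ\|\hat{\mathbf{w}}\|_p=\{\hat{\mathbf{z}}:\hat{\mathbf{w}}[d]\neq0\Rightarrow\hat{\mathbf{z}}[d]=p\,e^{\mathrm{i}\phi_{\hat{\mathbf{w}}[d]}}|\hat{\mathbf{w}}[d]|^{p-1}\}$. ''Converges in direction'' means the normalized sequence has a limit; ''almost all'' means outside a Lebesgue-null set. *)

(* Defs.v *)
From HB Require Import structures.
From mathcomp Require Import all_boot all_order all_algebra.
From mathcomp Require Import all_classical all_reals all_analysis.
Set Implicit Arguments. Unset Strict Implicit. Unset Printing Implicit Defensive.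
Import Order.TTheory GRing.Theory Num.Theory.
Import numFieldNormedType.Exports.
Local Open Scope classical_set_scope.
Local Open Scope ring_scope.

Section Defs.
Variable R : realType.

(* access with an index taken modulo D (D > 0 in all uses) *)
Definition modget (D : nat) (v : 'I_D -> R) (k : nat) : R :=
  match @insub nat (fun i => i < D)%N 'I_D (k %% D)%N with
  | Some i => v i | None => 0 end.

Definition dotp (D : nat) (a b : 'I_D -> R) : R := \sum_(i < D) a i * b i.

Definition enorm (D : nat) (a : 'I_D -> R) : R := Num.sqrt (\sum_(i < D) a i ^+ 2).

Definition cconv (D : nat) (h u : 'I_D -> R) : 'I_D -> R :=
  fun d => (Num.sqrt D%:R)^-1 * \sum_(k < D) u k * modget h (d + k)%N.

(* stored 0-based: the paper's u_l is (layer u (l-1)) *)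
Definition layer (L D : nat) (u : 'I_L -> 'I_D -> R) (l : nat) : 'I_D -> R :=
  fun d => match @insub nat (fun i => i < L)%N 'I_L l with
           | Some i => u i d | None => 0 end.

Definition fconv (L D : nat) (u : 'I_L -> 'I_D -> R) (x : 'I_D -> R) : R :=
  dotp (foldl (@cconv D) x [seq layer u l | l <- iota 0 (L - 1)]) (layer u (L - 1)).

Definition basisv (D : nat) (i : 'I_D) : 'I_D -> R := fun j => (i == j)%:R.

(* P_conv(u): the linear predictor w with f_u(x) = <x, w> for all x,
   i.e. w[d] = f_u(e_d) *)
Definition Pconv (L D : nat) (u : 'I_L -> 'I_D -> R) : 'I_D -> R :=
  fun d => fconv u (basisv d).

Definition lossw (N D : nat) (X : 'I_N -> 'I_D -> R) (y : 'I_N -> R)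
  (w : 'I_D -> R) : R := \sum_(n < N) expR (- (y n * dotp (X n) w)).

Definition lossu (N L D : nat) (X : 'I_N -> 'I_D -> R) (y : 'I_N -> R)
  (u : 'I_L -> 'I_D -> R) : R := lossw X y (Pconv u).

Definition upd1 (D : nat) (w : 'I_D -> R) (d : 'I_D) (t : R) : 'I_D -> R :=
  fun d' => if d' == d then w d' + t else w d'.

Definition upd2 (L D : nat) (u : 'I_L -> 'I_D -> R) (l : 'I_L) (d : 'I_D) (t : R)
  : 'I_L -> 'I_D -> R :=
  fun l' d' => if (l' == l) && (d' == d) then u l' d' + t else u l' d'.

Definition gradw (D : nat) (F : ('I_D -> R) -> R) (w : 'I_D -> R) : 'I_D -> R :=
  fun d => derive1 (fun t => F (upd1 w d t)) 0.

Definition gradu (L D : nat) (F : ('I_L -> 'I_D -> R) -> R) (u : 'I_L -> 'I_D -> R)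
  : 'I_L -> 'I_D -> R :=
  fun l d => derive1 (fun t => F (upd2 u l d t)) 0.

Definition pnorm (L D : nat) (u : 'I_L -> 'I_D -> R) : R :=
  Num.sqrt (\sum_(l < L) \sum_(d < D) u l d ^+ 2).

(* step size eta is below the (inverse) local Lipschitz constant of the
   gradient at u: eta > 0 and on some ball around u the gradient is
   beta-Lipschitz with eta < 1/beta *)
Definition step_ok (L D : nat) (F : ('I_L -> 'I_D -> R) -> R)
  (u : 'I_L -> 'I_D -> R) (eta : R) : Prop :=
  0 < eta /\
  exists r beta : R, 0 < r /\ 0 < beta /\ eta < beta^-1 /\
    forall v v' : 'I_L -> 'I_D -> R,
      pnorm (fun l d => v l d - u l d) < r ->
      pnorm (fun l d => v' l d - u l d) < r ->
      pnorm (fun l d => gradu F v l d - gradu F v' l d)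
        <= beta * pnorm (fun l d => v l d - v' l d).

Definition cvg_to_vec (I : Type) (s : nat -> I -> R) (l : I -> R) : Prop :=
  forall i, (fun t => s t i) @ \oo --> l i.

Definition dir_cvg_w (D : nat) (s : nat -> 'I_D -> R) : Prop :=
  exists l, cvg_to_vec (fun t d => s t d / enorm (s t)) l.

Definition dir_cvg_u (L D : nat) (s : nat -> 'I_L -> 'I_D -> R) : Prop :=
  exists l : 'I_L -> 'I_D -> R,
    forall i j, (fun t => s t i j / pnorm (s t)) @ \oo --> l i j.

Definition dft (D : nat) (w : 'I_D -> R) (d : 'I_D) : R * R :=
  ((Num.sqrt D%:R)^-1 * \sum_(p < D) w p * cos (2 * pi * (p * d)%N%:R / D%:R),
   - ((Num.sqrt D%:R)^-1 * \sum_(p < D) w p * sin (2 * pi * (p * d)%N%:R / D%:R))).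

Definition cabs (z : R * R) : R := Num.sqrt (z.1 ^+ 2 + z.2 ^+ 2).

(* e^{i phi_z} = z/|z| for z <> 0; convention phi_0 = 0 *)
Definition phase (z : R * R) : R * R :=
  if z == (0, 0) then (1, 0) else (z.1 / cabs z, z.2 / cabs z).

(* Clarke subdifferential of ||.||_p at what (p = 2/L), membership of zhat *)
Definition in_clarke (L D : nat) (what zhat : 'I_D -> R * R) : Prop :=
  let p : R := 2 / L%:R in
  if L == 2%N then
    forall d, cabs (zhat d) <= 1 /\
      (what d != (0, 0) -> zhat d = phase (what d))
  else
    forall d, what d != (0, 0) ->
      zhat d = (p * (phase (what d)).1 * cabs (what d) `^ (p - 1),
                p * (phase (what d)).2 * cabs (what d) `^ (p - 1)).

Definition fosp (N L D : nat) (X : 'I_N -> 'I_D -> R) (y : 'I_N -> R)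
  (w : 'I_D -> R) : Prop :=
  (forall n, 1 <= y n * dotp (X n) w) /\
  exists alpha : 'I_N -> R,
    (forall n, 0 <= alpha n) /\
    (forall n, 1 < y n * dotp (X n) w -> alpha n = 0) /\
    in_clarke L (dft w)
      (fun d => (\sum_(n < N) alpha n * y n * (dft (X n) d).1,
                 \sum_(n < N) alpha n * y n * (dft (X n) d).2)).

Definition box_vol (T : finType) (a b : T -> R) : R := \prod_(i : T) (b i - a i).

Definition null_set (T : finType) (A : set (T -> R)) : Prop :=
  forall eps : R, 0 < eps ->
    exists a b : nat -> T -> R,
      (forall k i, a k i <= b k i) /\
      (forall f, A f -> exists k, forall i, a k i <= f i <= b k i) /\
      (forall n, \sum_(k < n) box_vol (a k) (b k) <= eps).

Definition null_set2 (T1 T2 : finType) (A : set (T1 -> T2 -> R)) : Prop :=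
  null_set [set f : T1 * T2 -> R | A (fun i j => f (i, j))].

Definition lin_separable (N D : nat) (X : 'I_N -> 'I_D -> R) (y : 'I_N -> R) : Prop :=
  exists w : 'I_D -> R, forall n, 0 < y n * dotp (X n) w.

End Defs.

(* Main.v *)
Require Import Defs.
From HB Require Import structures.
From mathcomp Require Import all_boot all_order all_algebra.
From mathcomp Require Import all_classical all_reals all_analysis.
From mathcomp Require Import complex ring lra.
Import Order.TTheory GRing.Theory Num.Theory.
Import numFieldNormedType.Exports.
Set Implicit Arguments. Unset Strict Implicit. Unset Printing Implicit Defensive.
Local Open Scope classical_set_scope.
Local Open Scope ring_scope.
Local Open Scope complex_scope.

(* The Fourier transform diagonalises the network: with [F] the DFT,
   [F w = prod_l F u_l], and gradient descent reads
   [F u_l += eta * F z * prod_(i != l) conj (F u_i)], where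
   [z = sum_n exp (- margin_n) y_n x_n].

   Comparing the Lipschitz constant with the second derivative of the loss along
   directions supported on two layers gives [eta |F z prod_(i != l, k) F u_i| <= 1].
   Each difference [|F u_l|^2 - |F u_k|^2] is multiplied at every step by
   [1 - (eta |F z prod_(i != l, k) F u_i|)^2], hence stays bounded, while
   [|u|] diverges: in the limit direction [ubar] all layers have the same modulus
   at every frequency, so [P ubar] is a nonzero multiple of [wbar].  An ultrafilter
   limit of the normalised weights writes the limit direction [zbar] of [z] as a
   nonnegative combination of support vectors, and a weighted Cesaro argument gives
   [ubar = lam * grad], i.e. [F (P ubar) = lam r^(L-1) F zbar] with [r = |F ubar_l|^2].
   This is stationarity at the frequencies where [F wbar] does not vanish, which is
   all that is required for [L > 2].

   For [L = 2] suppose [lam |F zbar| > 1] at a frequency where [F wbar] vanishes.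
   Since [eta |z| -> 0] (curvature in the direction of [u] itself), the component of
   [F w] along [F zbar] at that frequency becomes positive, unless
   [|F u_1| = |F u_2|] initially, and from then on it grows at least as fast as the
   energy of a frequency carrying [wbar], contradicting that it vanishes in the limit.
   The excluded initialisations form a quadric, for whatever step sizes; no dataset
   has to be excluded. *)

(** * Circular convolution *)

Section Convolution.
Variables (R : realType) (D' : nat).
Notation D := D'.+1.
Implicit Types (x a b h v : 'I_D -> R).

Lemma modgetE h (i j : 'I_D) : modget h (i + j)%N = h (i + j).
Proof.
rewrite /modget; case: insubP => [k _ kE|]; last by rewrite ltn_mod.
by congr h; apply/val_inj; rewrite /= kE.
Qed.

Lemma sqrtD_gt0 : 0 < Num.sqrt (D%:R : R).
Proof. by rewrite sqrtr_gt0 ltr0n. Qed.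

Lemma sqrtD_neq0 : Num.sqrt (D%:R : R) != 0.
Proof. by rewrite gt_eqF ?sqrtD_gt0. Qed.

Lemma cconvE h a d :
  cconv h a d = (Num.sqrt D%:R)^-1 * \sum_(k < D) a k * h (d + k).
Proof. by rewrite /cconv; under eq_bigr do rewrite modgetE. Qed.

(** Both sides expand to a double sum of [a j * b i * x (d + i + j)], symmetric in the two filters.
    Layers can thus be permuted although [cconv] is a correlation. *)
Lemma cconvAC : right_commutative (@cconv R D).
Proof.
move=> x a b; apply/funext => d; rewrite !cconvE; congr (_ * _).
under eq_bigr do rewrite cconvE mulrCA mulr_sumr.
under [RHS]eq_bigr do rewrite cconvE mulrCA mulr_sumr.
rewrite -!mulr_sumr exchange_big /=; congr (_ * _).
apply: eq_bigr => i _; apply: eq_bigr => j _.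
by rewrite mulrCA addrAC.
Qed.

(** The final inner product is one more convolution, read at index 0, so the last layer is treated
    like all the others. *)
Lemma dotpE_cconv h v : dotp h v = Num.sqrt D%:R * cconv h v 0.
Proof.
rewrite cconvE mulrA mulfV ?sqrtD_neq0// mul1r.
by apply: eq_bigr => i _; rewrite add0r mulrC.
Qed.

Lemma dotp_cconvC h a b : dotp (cconv h a) b = dotp (cconv h b) a.
Proof. by rewrite !dotpE_cconv cconvAC. Qed.

Lemma dotpC a b : dotp a b = dotp b a.
Proof. by apply: eq_bigr => i _; rewrite mulrC. Qed.

Lemma dotpDr a b v : dotp v (fun d => a d + b d) = dotp v a + dotp v b.
Proof. by rewrite -big_split; apply: eq_bigr => i _; rewrite mulrDr. Qed.

Lemma dotpZr (c : R) a v : dotp v (fun d => c * a d) = c * dotp v a.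
Proof. by rewrite /dotp mulr_sumr; apply: eq_bigr => i _; rewrite mulrCA. Qed.

Lemma dotpZl (c : R) a v : dotp (fun d => c * a d) v = c * dotp a v.
Proof. by rewrite dotpC dotpZr dotpC. Qed.

Lemma dotp_suml (I : Type) (r : seq I) (f : I -> 'I_D -> R) v :
  dotp (fun d => \sum_(n <- r) f n d) v = \sum_(n <- r) dotp (f n) v.
Proof. by rewrite exchange_big; apply: eq_bigr => i _; rewrite mulr_suml. Qed.

Lemma cconvZr h (c : R) a : cconv h (fun d => c * a d) = (fun d => c * cconv h a d).
Proof.
apply/funext => d; rewrite !cconvE [RHS]mulrCA [X in _ = _ * X]mulr_sumr; congr (_ * _).
by apply: eq_bigr => i _; rewrite mulrA.
Qed.

Lemma cconv_suml (I : Type) (r : seq I) (c : I -> R) (f : I -> 'I_D -> R) a :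
  cconv (fun d => \sum_(n <- r) c n * f n d) a =
  (fun d => \sum_(n <- r) c n * cconv (f n) a d).
Proof.
apply/funext => d; rewrite cconvE.
under eq_bigr do rewrite mulr_sumr.
rewrite exchange_big mulr_sumr; apply: eq_bigr => n _ /=.
rewrite cconvE [RHS]mulrCA [X in _ = _ * X]mulr_sumr; congr (_ * _).
by apply: eq_bigr => i _; rewrite mulrCA.
Qed.

(** * Layers as a permutable list of filters *)

Section Layers.
Variable L : nat.
Implicit Types (u : 'I_L -> 'I_D -> R) (s : seq 'I_L) (l k : 'I_L).

Definition cfold u s x : 'I_D -> R := foldl (@cconv R D) x [seq u i | i <- s].

Lemma cfold_rcons u s l x : cfold u (rcons s l) x = cconv (cfold u s x) (u l).
Proof. by rewrite /cfold map_rcons foldl_rcons. Qed.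

Lemma cfold_cons u s l x : cfold u (l :: s) x = cconv (cfold u s x) (u l).
Proof.
elim/last_ind: s => [//|s k IH].
by rewrite -rcons_cons !cfold_rcons IH cconvAC.
Qed.

Lemma cfold_cat u s s' x : cfold u (s ++ s') x = cfold u s' (cfold u s x).
Proof. by rewrite /cfold map_cat foldl_cat. Qed.

Lemma cfoldC u s s' x : cfold u s (cfold u s' x) = cfold u s' (cfold u s x).
Proof. by elim: s => [//|l s IH]; rewrite [LHS]cfold_cons IH -cfold_cons (cfold_cons u s). Qed.

Lemma cfold_perm u s s' x : perm_eq s s' -> cfold u s x = cfold u s' x.
Proof.
move=> p; apply: (@catCA_perm_subst _ _ (fun s => cfold u s x) _ s s' p) => s1 s2 s3 /=.
by rewrite !cfold_cat (cfoldC _ s2).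
Qed.

Lemma eq_cfold u u' s x : {in s, forall i, u i = u' i} ->
  cfold u s x = cfold u' s x.
Proof. by move=> uu'; rewrite /cfold; congr foldl; apply/eq_in_map. Qed.

Lemma cfold_suml (I : Type) (r : seq I) (c : I -> R) (f : I -> 'I_D -> R) u s :
  cfold u s (fun d => \sum_(n <- r) c n * f n d) =
  (fun d => \sum_(n <- r) c n * cfold u s (f n) d).
Proof.
elim: s => [//|l s IH]; rewrite cfold_cons IH cconv_suml.
by apply/funext => d; apply: eq_bigr => n _; rewrite cfold_cons.
Qed.

Definition others l : seq 'I_L := rem l (enum 'I_L).

Lemma perm_others l : perm_eq (enum 'I_L) (l :: others l).
Proof. by rewrite perm_to_rem// mem_enum. Qed.

Lemma mem_others l i : (i \in others l) = (i != l).
Proof. by rewrite mem_rem_uniq ?enum_uniq// inE mem_enum andbT. Qed.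

Lemma others_uniq l : uniq (others l).
Proof. by rewrite rem_uniq ?enum_uniq. Qed.

Lemma big_others (S : Type) (idx : S) (op : Monoid.com_law idx) l (F : 'I_L -> S) :
  \big[op/idx]_(i <- others l) F i = \big[op/idx]_(i < L | i != l) F i.
Proof.
rewrite -[RHS]big_filter; apply: perm_big; apply: uniq_perm.
- exact: others_uniq.
- by rewrite filter_uniq// index_enum_uniq.
by move=> i; rewrite mem_others mem_filter mem_index_enum andbT.
Qed.

Definition others2 l k : seq 'I_L := rem k (others l).

Lemma perm_others2 l k : l != k -> perm_eq (others l) (k :: others2 l k).
Proof. by move=> lk; rewrite perm_to_rem// mem_others eq_sym. Qed.

Lemma mem_others2 l k i : (i \in others2 l k) = (i != k) && (i != l).
Proof. by rewrite mem_rem_uniq ?others_uniq// inE mem_others. Qed.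

Lemma perm_others2C l k : l != k -> perm_eq (others2 l k) (others2 k l).
Proof.
move=> lk; apply: uniq_perm; do ?exact/rem_uniq/others_uniq.
by move=> i; rewrite !mem_others2 andbC.
Qed.

Lemma layerE u l : layer u l = u l.
Proof. by apply/funext => d; rewrite /layer (@valK _ _ 'I_L l). Qed.

Lemma fconv_enum u x : (0 < L)%N ->
  fconv u x = Num.sqrt D%:R * cfold u (enum 'I_L) x 0.
Proof.
move=> L0; rewrite /fconv dotpE_cconv -foldl_rcons /cfold.
suff -> : rcons [seq layer u j | j <- iota 0 (L - 1)] (layer u (L - 1)) =
          [seq u i | i <- enum 'I_L] by [].
rewrite -map_rcons (_ : rcons _ _ = iota 0 L); last first.
  by rewrite -cats1 -(iotaD 0 (L - 1) 1) subnK.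
by rewrite -val_enum_ord -map_comp; apply: eq_map => l /=; rewrite layerE.
Qed.

(** Any layer can be moved to the last position, which exhibits the network as linear in that
    layer. *)
Lemma fconvE l u x : fconv u x = dotp (cfold u (others l) x) (u l).
Proof.
rewrite fconv_enum ?(leq_ltn_trans _ (ltn_ord l))// dotpE_cconv -cfold_cons.
by rewrite (cfold_perm _ _ (perm_others l)).
Qed.

Lemma fconvE2 l k u x : l != k ->
  fconv u x = dotp (cconv (cfold u (others2 l k) x) (u k)) (u l).
Proof.
by move=> lk; rewrite (fconvE l) (cfold_perm _ _ (perm_others2 lk)) cfold_cons.
Qed.

Lemma fconv_suml (I : Type) (r : seq I) (c : I -> R) (f : I -> 'I_D -> R) u :
  (0 < L)%N ->
  fconv u (fun d => \sum_(n <- r) c n * f n d) = \sum_(n <- r) c n * fconv u (f n).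
Proof.
move=> L0; rewrite fconv_enum// cfold_suml mulr_sumr; apply: eq_bigr => n _.
by rewrite fconv_enum// mulrCA.
Qed.

Lemma dotp_Pconv u x : (0 < L)%N -> dotp x (Pconv u) = fconv u x.
Proof.
move=> L0; rewrite [in RHS](_ : x = fun d => \sum_(i < D) x i * basisv R i d).
  by rewrite fconv_suml.
apply/funext => d; rewrite (bigD1 d)//= big1 ?addr0 /basisv ?eqxx ?mulr1//.
by move=> i /negbTE ->; rewrite mulr0.
Qed.

Lemma upd2_neq u l d t i : i != l -> upd2 u l d t i = u i.
Proof. by move=> il; apply/funext => j; rewrite /upd2 (negbTE il). Qed.

Lemma cfold_upd2 u l d t x :
  cfold (upd2 u l d t) (others l) x = cfold u (others l) x.
Proof. by apply: eq_cfold => i; rewrite mem_others => il; rewrite upd2_neq. Qed.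

Lemma fconv_upd2 u l d t x :
  fconv (upd2 u l d t) x = fconv u x + t * cfold u (others l) x d.
Proof.
rewrite !(fconvE l) cfold_upd2 /dotp (bigD1 d)//= [in RHS](bigD1 d)//= /upd2 !eqxx /=.
rewrite mulrDr -!addrA; congr (_ + _); rewrite addrC [t * _]mulrC; congr (_ + _).
by apply: eq_bigr => i /negbTE id; rewrite id.
Qed.

(* [cconv] is a correlation; its adjoint is the ordinary circular convolution. *)
Definition aconv a v : 'I_D -> R :=
  fun d => (Num.sqrt D%:R)^-1 * \sum_(k < D) a k * v (d - k).

Lemma dotp_aconv h a v : dotp (cconv h a) v = dotp h (aconv a v).
Proof.
rewrite /dotp.
under eq_bigr do rewrite cconvE -mulrA mulr_suml.
under [RHS]eq_bigr do rewrite /aconv mulrCA mulr_sumr.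
rewrite -!mulr_sumr; congr (_ * _).
rewrite exchange_big [RHS]exchange_big; apply: eq_bigr => k _ /=.
rewrite [RHS](reindex_inj (addIr k)) /=; apply: eq_bigr => d _.
by rewrite addrK mulrAC mulrC mulrA.
Qed.

Lemma dotp_cfold u s x v :
  dotp (cfold u s x) v = dotp x (foldr (fun i => aconv (u i)) v s).
Proof.
elim/last_ind: s v => [//|s l IH] v.
by rewrite cfold_rcons dotp_aconv IH foldr_rcons.
Qed.

(** Moving each filter across [dotp] to its adjoint turns the network into an inner product with a
    vector depending on [u] alone. *)
Lemma Pconv_foldr l u :
  Pconv u = foldr (fun i => aconv (u i)) (u l) (others l).
Proof.
apply/funext => d; rewrite /Pconv (fconvE l) dotp_cfold /dotp (bigD1 d)//=.
rewrite big1 ?addr0 /basisv ?eqxx ?mul1r// => i.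
by rewrite eq_sym => /negbTE ->; rewrite mul0r.
Qed.

End Layers.
End Convolution.

(** * Discrete Fourier transform *)

Section SquaredModulus.
Variable R : realType.
Implicit Types (z c : R[i]).

(** Conjugation and squared modulus are spelled out on real and imaginary parts, with [nsq] valued
    in [R], so that identities fall to [ring] after destructuring. *)
Definition cj (z : R[i]) : R[i] := let: a +i* b := z in a +i* - b.

Definition nsq z : R := let: a +i* b := z in a ^+ 2 + b ^+ 2.

Lemma nsqM z c : nsq (z * c) = nsq z * nsq c.
Proof. by case: z c => [a b] [e f]; rewrite /cj /nsq /=; ring. Qed.

Lemma nsq_conj z : nsq (cj z) = nsq z.
Proof. by case: z => a b; rewrite /cj /nsq /=; ring. Qed.

Lemma nsq_ge0 z : 0 <= nsq z.
Proof. by case: z => a b; rewrite /cj /nsq /= addr_ge0 ?sqr_ge0. Qed.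

Lemma nsq_prod (I : Type) (r : seq I) (P : pred I) (f : I -> R[i]) :
  nsq (\prod_(i <- r | P i) f i) = \prod_(i <- r | P i) nsq (f i).
Proof.
apply: (big_morph _ nsqM).
by rewrite /nsq /= expr1n expr0n addr0.
Qed.

Lemma mul_conj z : z * cj z = (nsq z)%:C.
Proof. by case: z => a b; apply/eqP; rewrite eq_complex /cj /nsq /=; apply/andP; split; apply/eqP; ring. Qed.

Lemma nsq_real (a : R) : nsq a%:C = a ^+ 2.
Proof. by rewrite /cj /nsq /= expr0n addr0. Qed.

Lemma conjM z c : cj (z * c) = cj z * cj c.
Proof. by case: z c => [a b] [e f]; apply/eqP; rewrite eq_complex /cj /nsq /=; apply/andP; split; apply/eqP; ring. Qed.

Lemma conj_sum (I : Type) (r : seq I) (f : I -> R[i]) :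
  cj (\sum_(i <- r) f i) = \sum_(i <- r) cj (f i).
Proof.
apply: (big_morph cj) => [[a b] [e f']|]; apply/eqP;
  by rewrite eq_complex /cj /nsq /= ?opprD ?oppr0 !eqxx.
Qed.

Lemma cj_real (a : R) : cj a%:C = a%:C.
Proof. by rewrite /cj /nsq /= oppr0. Qed.

Lemma real_complexM (a b : R) : (a * b)%:C = a%:C * b%:C.
Proof. exact: rmorphM. Qed.

Lemma real_complex_sum (I : Type) (r : seq I) (f : I -> R) :
  (\sum_(i <- r) f i)%:C = \sum_(i <- r) (f i)%:C.
Proof. exact: rmorph_sum. Qed.

End SquaredModulus.
Arguments cj : simpl never.
Arguments nsq : simpl never.

Section Dft.
Variables (R : realType) (D' : nat).
Notation D := D'.+1.
Implicit Types (x a b h v w : 'I_D -> R) (d : 'I_D).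

(** This is the character exp(-2 pi i n / D), taken on natural numbers and [D]-periodic. *)
Definition chi (n : nat) : R[i] :=
  let t : R := 2 * pi * n%:R / D%:R in cos t +i* - sin t.
Arguments chi : simpl never.

Definition dftc w d : R[i] := (dft w d).1 +i* (dft w d).2.
Arguments dftc : simpl never.

Lemma chiD m n : chi (m + n) = chi m * chi n.
Proof.
rewrite /chi natrD mulrDr mulrDl cosD sinD; apply/eqP.
by rewrite eq_complex /=; apply/andP; split; apply/eqP; ring.
Qed.

Lemma chi0 : chi 0 = 1.
Proof. by rewrite /chi mulr0 mul0r cos0 sin0 oppr0. Qed.

Lemma chi_period k : chi (D * k) = 1.
Proof.
elim: k => [|k IH]; first by rewrite muln0 chi0.
rewrite mulnS chiD IH mulr1 /chi -mulrA divff ?pnatr_eq0// mulr1 mulrC.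
rewrite mulr_natr -[_ *+ 2]add0r cosD2pi sinD2pi cos0 sin0 oppr0 //.
Qed.

Lemma chi_mod m n : chi (m %% D * n) = chi (m * n).
Proof.
by rewrite [in RHS](divn_eq m D) mulnDl chiD -mulnA mulnCA chi_period mul1r.
Qed.

Lemma chi_addl (i j : 'I_D) n : chi ((i + j)%R * n) = chi (i * n) * chi (j * n).
Proof. by rewrite /= chi_mod mulnDl chiD. Qed.

Lemma nsq_chi n : nsq (chi n) = 1.
Proof. by rewrite /nsq /chi /= sqrrN cos2Dsin2. Qed.

Lemma chi_conj n : chi n * cj (chi n) = 1.
Proof. by rewrite mul_conj nsq_chi. Qed.

(** With [t] strictly between 0 and pi, the real part is cos(2t) = 1 - 2 sin(t)^2 < 1. *)
Lemma chi_eq1 r : (0 < r < D)%N -> chi r != 1.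
Proof.
move=> /andP[r0 rD]; rewrite /chi eq_complex /= negb_and; apply/orP; left.
set t := pi * r%:R / D%:R : R.
have -> : 2 * pi * r%:R / D%:R = t *+ 2 by rewrite /t -[RHS]mulr_natr; ring.
have : 0 < sin t.
  apply: sin_gt0_pi; rewrite /t divr_gt0 ?mulr_gt0 ?pi_gt0 ?ltr0n//=.
  by rewrite ltr_pdivrMr ?ltr0n// ltr_pM2l ?pi_gt0// ltr_nat.
move=> s0; rewrite cos_mulr2n cos2sin2 lt_eqF// -[_ *+ 2]mulr_natr.
have : 0 < sin t ^+ 2 by rewrite exprn_gt0.
lra.
Qed.

Lemma chi_inj (p q : 'I_D) : chi p = chi q -> p = q.
Proof.
wlog pq : p q / (p <= q)%N => [hw|].
  by case/orP: (leq_total p q) => ? ?; [exact: hw|apply/esym/hw].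
move=> e; apply/val_inj/eqP; rewrite /= eqn_leq pq /= leqNgt; apply/negP => lt.
have : chi (q - p) != 1.
  by apply: chi_eq1; rewrite subn_gt0 lt (leq_ltn_trans (leq_subr _ _)).
case/eqP; rewrite -[LHS]mulr1 -(chi_conj p) mulrA -chiD subnK //.
by rewrite -e chi_conj.
Qed.

(** For distinct [p], [q], shifting the summation index by one multiplies the sum by
    [chi p * cj (chi q)], which differs from 1; the sum therefore vanishes. *)
Lemma chi_orthogonal (p q : 'I_D) :
  \sum_(d < D) chi (p * d) * cj (chi (q * d)) = (D%:R * (p == q)%:R)%:C.
Proof.
have [->|pq] := eqVneq p q.
  under eq_bigr do rewrite chi_conj.
  by rewrite sumr_const card_ord mulr1 rmorph_nat.
rewrite mulr0; set S := \sum_(d < D) _.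
have : chi p * cj (chi q) * S = S.
  rewrite /S mulr_sumr [RHS](reindex_inj (addIr (inZp 1 : 'I_D))) /=.
  apply: eq_bigr => d _.
  have E (r : 'I_D) : chi (r * ((d + 1 %% D) %% D)) = chi (r * d) * chi r.
    by rewrite mulnC chi_mod mulnDl chiD chi_mod mul1n mulnC.
  by rewrite !E conjM; ring.
move=> e; have : (chi p * cj (chi q) - 1) * S = 0 by rewrite mulrBl e mul1r subrr.
move/eqP; rewrite mulf_eq0 => /orP[|/eqP //]; rewrite subr_eq0 => /eqP e1.
case/eqP: pq; apply: chi_inj.
by rewrite -[RHS]mul1r -e1 -mulrA [cj _ * _]mulrC chi_conj mulr1.
Qed.

Lemma dftcE w d :
  dftc w d = ((Num.sqrt D%:R)^-1)%:C * \sum_(p < D) (w p)%:C * chi (p * d).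
Proof.
have -> : \sum_(p < D) (w p)%:C * chi (p * d) =
  (\sum_(p < D) w p * cos (2 * pi * (p * d)%N%:R / D%:R)) +i*
   - (\sum_(p < D) w p * sin (2 * pi * (p * d)%N%:R / D%:R)).
  rewrite -sumrN; elim/big_rec3: _ => [//|p z s c _ ->]; apply/eqP.
  by rewrite /chi eq_complex /=; apply/andP; split; apply/eqP; ring.
rewrite /dftc; apply/eqP; rewrite eq_complex /=; apply/andP; split; apply/eqP; ring.
Qed.

Lemma dftcZ (c : R) w d : dftc (fun i => c * w i) d = c%:C * dftc w d.
Proof.
rewrite !dftcE [RHS]mulrCA [X in _ = _ * X]mulr_sumr; congr (_ * _).
by apply: eq_bigr => p _; rewrite rmorphM mulrA.
Qed.

Lemma dftcD a b d : dftc (fun i => a i + b i) d = dftc a d + dftc b d.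
Proof.
rewrite !dftcE -mulrDr -big_split; congr (_ * _).
by apply: eq_bigr => p _; rewrite rmorphD mulrDl.
Qed.

(** The conjugate on the filter comes from the shift [d + k] of a correlation: substituting the
    shifted index leaves [chi] at [- k]. *)
Lemma dftc_cconv h a d : dftc (cconv h a) d = dftc h d * cj (dftc a d).
Proof.
rewrite !dftcE conjM conj_sum cj_real [RHS]mulrACA -mulrA; congr (_ * _).
under eq_bigr do rewrite cconvE real_complexM real_complex_sum -mulrA mulr_suml.
rewrite -mulr_sumr; congr (_ * _).
rewrite exchange_big [RHS]mulrC mulr_suml /=; apply: eq_bigr => k _.
rewrite mulr_sumr (reindex_inj (addIr (- k))) /=; apply: eq_bigr => m _.
rewrite subrK real_complexM conjM cj_real -[in RHS](subrK k m) chi_addl subrK.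
have := chi_conj (k * d); set A := chi _; set B := chi _.
by move=> e; rewrite -[LHS]mulr1 -e; ring.
Qed.

Lemma dftc_aconv a v d : dftc (aconv a v) d = dftc a d * dftc v d.
Proof.
rewrite !dftcE [RHS]mulrACA -mulrA; congr (_ * _).
under eq_bigr do rewrite /aconv real_complexM real_complex_sum -mulrA mulr_suml.
rewrite -mulr_sumr; congr (_ * _).
rewrite exchange_big mulr_suml /=; apply: eq_bigr => k _.
rewrite mulr_sumr (reindex_inj (addIr k)) /=; apply: eq_bigr => m _.
by rewrite addrK real_complexM chi_addl; ring.
Qed.

Lemma parseval w : \sum_(d < D) nsq (dftc w d) = \sum_(p < D) w p ^+ 2.
Proof.
apply: complexI; rewrite !real_complex_sum.
under eq_bigr => d _ do rewrite -mul_conj dftcE conjM conj_sum cj_real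
  mulrACA mulr_suml.
rewrite -mulr_sumr exchange_big /= mulr_sumr; apply: eq_bigr => p _.
under eq_bigr do rewrite mulr_sumr.
rewrite exchange_big /=.
under eq_bigr => q _ do under eq_bigr => d _ do rewrite conjM cj_real mulrACA.
under eq_bigr => q _ do rewrite -mulr_sumr chi_orthogonal.
rewrite (bigD1 p)//= big1 ?addr0 => [|q /negbTE qp]; last first.
  by rewrite eq_sym qp mulr0 mulr0.
rewrite eqxx mulr1 -!real_complexM; congr (_%:C).
rewrite -invfM -expr2 sqr_sqrtr ?ler0n// mulrCA mulVf ?pnatr_eq0//.
by rewrite mulr1 expr2.
Qed.

Section Layers.
Variable L : nat.
Implicit Types (u : 'I_L -> 'I_D -> R) (s : seq 'I_L) (l k : 'I_L).

Lemma dftc_cfold u s x d :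
  dftc (cfold u s x) d = dftc x d * \prod_(i <- s) cj (dftc (u i) d).
Proof.
elim: s => [|l s IH]; first by rewrite big_nil mulr1.
by rewrite cfold_cons dftc_cconv IH big_cons -mulrA [X in _ * X]mulrC.
Qed.

(** [Pconv] is assembled from the adjoints [aconv], whose transforms multiply without
    conjugation. *)
Lemma dftc_Pconv u d : (0 < L)%N -> dftc (Pconv u) d = \prod_(i < L) dftc (u i) d.
Proof.
case: L u => [//|n] u _; rewrite (Pconv_foldr ord0) (bigD1 ord0)//= mulrC.
rewrite -big_others; elim: (others ord0) => [|i s IH] /=.
  by rewrite big_nil mul1r.
by rewrite dftc_aconv IH big_cons mulrA.
Qed.

End Layers.
End Dft.
Arguments chi : simpl never.
Arguments dftc : simpl never.

(** * Gradient of the loss and curvature bound on the step size *)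

Section RealDerivatives.
Variable R : realType.

(** The exponent is quadratic because margins are quadratic in [s] along a line that moves two
    layers. *)
Lemma is_derive_exp_quadratic (a b c t : R) :
  is_derive t 1 (fun s : R => expR (- (a + s * b + s ^+ 2 * c)))
    (- (b + 2 * t * c) * expR (- (a + t * b + t ^+ 2 * c))).
Proof.
pose q : R -> R := - (cst a + b \*: (id : R -> R) + c \*: (id : R -> R) ^+ 2).
have qE s : q s = - (a + s * b + s ^+ 2 * c).
  by rewrite /q !fctE /= /GRing.scale /=; ring.
rewrite (_ : (fun s : R => _) = expR \o q); last first.
  by apply/funext => s /=; rewrite qE.
have dq : is_derive t 1 q (- (b + 2 * t * c)).
  apply: is_derive_eq; rewrite /GRing.scale /=; ring.
apply: is_derive_eq; rewrite -qE mulrC //.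
Qed.

Lemma derive_sum_exp_affine (n : nat) (a b : 'I_n -> R) :
  derive1 (fun t : R => \sum_(i < n) expR (- (a i + t * b i))) 0 =
  - \sum_(i < n) expR (- a i) * b i.
Proof.
rewrite derive1E (_ : (fun t : R => _) =
  \sum_(i < n) (fun s : R => expR (- (a i + s * b i + s ^+ 2 * 0)))); last first.
  by apply/funext => t; rewrite fct_sumE; apply: eq_bigr => i _; rewrite mulr0 addr0.
have D := is_derive_sum (fun i => is_derive_exp_quadratic (a i) (b i) 0 0).
rewrite derive_val -sumrN; apply: eq_bigr => i _.
by rewrite !(mul0r, mulr0, addr0) mulNr mulrC.
Qed.

(** The differentiated function is the slope of the loss along such a line, so the value is the
    second directional derivative of the loss. *)
Lemma is_derive_sum_quadratic_exp (n : nat) (m p q : 'I_n -> R) :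
  is_derive (0 : R) 1
    (fun s : R => - \sum_(i < n)
       (p i + s * (2 * q i)) * expR (- (m i + s * p i + s ^+ 2 * q i)))
    (\sum_(i < n) expR (- m i) * (p i ^+ 2 - 2 * q i)).
Proof.
pose g i : R -> R := (cst (p i) + (2 * q i) \*: (id : R -> R)) *
    (fun s : R => expR (- (m i + s * p i + s ^+ 2 * q i))).
rewrite (_ : (fun s : R => - _) = - \sum_(i < n) g i); last first.
  apply/funext => s; rewrite !fctE; congr (- _); rewrite fct_sumE.
  by apply: eq_bigr => i _; rewrite /g !fctE /= /GRing.scale /= [s * (2 * _)]mulrC.
have dg i : is_derive (0 : R) 1 (g i) (- (expR (- m i) * (p i ^+ 2 - 2 * q i))).
  have := is_derive_exp_quadratic (m i) (p i) (q i) 0 => D.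
  rewrite /g; apply: is_derive_eq.
  have e0 : - (m i + 0 * p i + 0 ^+ 2 * q i) = - m i by ring.
  by rewrite !fctE /GRing.scale /= e0; ring.
apply: is_derive_eq; rewrite sumrN opprK //.
Qed.

(** Only right difference quotients are controlled; were [df] above [c], a small positive [s] would
    give a quotient above [c]. *)
Lemma is_derive_le (f : R -> R) (df c e : R) : 0 < e ->
  is_derive (0 : R) 1 f df ->
  (forall s, 0 < s < e -> f s - f 0 <= s * c) -> df <= c.
Proof.
move=> e0 [dv <-] H; rewrite leNgt; apply/negP => lt.
move: dv; rewrite /derivable => /cvg_ex[l hl].
have ll : 'D_1 f 0 = l by apply: cvg_lim.
rewrite ll in lt.
move/cvgrPdist_lt: hl => /(_ (l - c)); rewrite subr_gt0 => /(_ lt).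
rewrite /prop_near1 /= /dnbhs /within /= => /nbhs_ballP[r /= r0 hr].
pose s := Num.min (r / 2) (e / 2).
have s0 : 0 < s by rewrite lt_min !divr_gt0.
have sr : s < r by rewrite gt_min; apply/orP; left; lra.
have se : s < e by rewrite gt_min; apply/orP; right; lra.
have := hr s; rewrite /ball /= sub0r normrN gtr0_norm// => /(_ sr).
move=> /(_ (lt0r_neq0 s0)) /=; rewrite addr0 /GRing.scale /= mulr1.
have := H s; rewrite s0 se => /(_ isT) hs.
move/ltr_normlW; have : s^-1 * (f s - f 0) <= c.
  by rewrite mulrC ler_pdivrMr// mulrC.
lra.
Qed.

End RealDerivatives.

(** * The loss along lines moving two layers *)

Section Loss.
Variables (R : realType) (D' L N : nat).
Notation D := D'.+1.
Variables (X : 'I_N -> 'I_D -> R) (y : 'I_N -> R).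
Hypothesis L_gt0 : (0 < L)%N.
Implicit Types (u : 'I_L -> 'I_D -> R) (l k : 'I_L) (a b : 'I_D -> R).

Definition margin u n : R := y n * fconv u (X n).

Definition residual u : 'I_D -> R :=
  fun d => \sum_(n < N) (expR (- margin u n) * y n) * X n d.

Lemma lossuE u : lossu X y u = \sum_(n < N) expR (- margin u n).
Proof. by apply: eq_bigr => n _; rewrite dotp_Pconv. Qed.

Lemma graduE u l d :
  gradu (lossu X y) u l d = - cfold u (others l) (residual u) d.
Proof.
rewrite /gradu (_ : (fun t => _) = fun t => \sum_(n < N)
  expR (- (margin u n + t * (y n * cfold u (others l) (X n) d)))); last first.
  apply/funext => t; rewrite lossuE; apply: eq_bigr => n _; congr (expR (- _)).
  by rewrite /margin fconv_upd2; ring.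
rewrite derive_sum_exp_affine cfold_suml; congr (- _); apply: eq_bigr => n _.
by rewrite mulrA.
Qed.

Lemma gradwE u d : gradw (lossw X y) (Pconv u) d = - residual u d.
Proof.
rewrite /gradw (_ : (fun t => _) = fun t => \sum_(n < N)
  expR (- (margin u n + t * (y n * X n d)))); last first.
  apply/funext => t; apply: eq_bigr => n _; congr (expR (- _)).
  rewrite /margin -dotp_Pconv// (_ : dotp _ (upd1 _ _ _) =
    dotp (X n) (Pconv u) + t * X n d); first by ring.
  rewrite /dotp (bigD1 d)//= [in RHS](bigD1 d)//= /upd1 eqxx mulrDr -!addrA.
  congr (_ + _); rewrite addrC mulrC; congr (_ + _).
  by apply: eq_bigr => i /negbTE ->.
rewrite derive_sum_exp_affine; congr (- _); apply: eq_bigr => n _.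
by rewrite mulrA.
Qed.

(** The network output with layers [k] and [l] replaced by [p] and [q] and the other layers frozen:
    a symmetric bilinear form in [p] and [q]. *)
Definition pairing u l k x p q := dotp (cconv (cfold u (others2 l k) x) p) q.

Section TwoLayers.
Variables (u : 'I_L -> 'I_D -> R) (l k : 'I_L) (a b : 'I_D -> R).
Hypothesis lk : l != k.

Notation B n := (pairing u l k (X n)).

Definition direction i : 'I_D -> R :=
  if i == l then a else if i == k then b else fun=> 0.

Definition shifted s : 'I_L -> 'I_D -> R := fun i d => u i d + s * direction i d.

(** Coefficients of [s] and [s ^+ 2] in the margin of [shifted s]; bilinearity of [pairing] rules
    out higher powers. *)
Notation p1 n := (y n * (B n (u k) a + B n (u l) b)).
Notation p2 n := (y n * B n a b).

Lemma direction_l : direction l = a.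
Proof. by rewrite /direction eqxx. Qed.

Lemma direction_k : direction k = b.
Proof. by rewrite /direction eq_sym (negbTE lk) eqxx. Qed.

Lemma cfold_shifted s x :
  cfold (shifted s) (others2 l k) x = cfold u (others2 l k) x.
Proof.
apply: eq_cfold => i; rewrite mem_others2 => /andP[/negbTE ik /negbTE il].
by apply/funext => d; rewrite /shifted /direction il ik mulr0 addr0.
Qed.

Lemma pairingC n p q : B n p q = B n q p.
Proof. by rewrite /pairing dotp_cconvC. Qed.

Lemma pairingDr n s p q r : B n p (fun d => q d + s * r d) = B n p q + s * B n p r.
Proof. by rewrite /pairing dotpDr dotpZr. Qed.

Lemma pairingDl n s p q r : B n (fun d => q d + s * r d) p = B n q p + s * B n r p.
Proof. by rewrite ![B n _ p]pairingC pairingDr. Qed.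

Lemma margin_shifted s n :
  margin (shifted s) n = margin u n + s * p1 n + s ^+ 2 * p2 n.
Proof.
rewrite /margin (fconvE2 _ _ lk) (fconvE2 _ (X n) lk) cfold_shifted -!/(pairing u l k (X n) _ _).
rewrite /shifted direction_l direction_k pairingDr !pairingDl (pairingC n b a) (pairingC n b (u l)); ring.
Qed.

Lemma grad_dir s :
  \sum_i \sum_d gradu (lossu X y) (shifted s) i d * direction i d =
  - \sum_(n < N) (p1 n + s * (2 * p2 n)) *
     expR (- (margin u n + s * p1 n + s ^+ 2 * p2 n)).
Proof.
have Z i : \sum_d gradu (lossu X y) (shifted s) i d * direction i d =
    - \sum_(n < N) expR (- margin (shifted s) n) * y n *
       dotp (cfold (shifted s) (others i) (X n)) (direction i).
  transitivity (- dotp (cfold (shifted s) (others i) (residual (shifted s))) (direction i)).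
    by rewrite /dotp -sumrN; apply: eq_bigr => d _; rewrite graduE mulNr.
  rewrite cfold_suml (dotp_suml _ (fun n d => _ * cfold _ _ (X n) d)); congr (- _).
  by apply: eq_bigr => n _; rewrite dotpZl.
have kl : k != l by rewrite eq_sym.
rewrite (bigD1 l)//= (bigD1 k kl)/= [X in _ + (_ + X)]big1 ?addr0; last first.
  move=> i /andP[/negbTE il /negbTE ik]; apply: big1 => d _.
  by rewrite /direction il ik mulr0.
rewrite !Z -opprD -big_split; congr (- _); apply: eq_bigr => n _ /=.
rewrite direction_l direction_k (cfold_perm _ _ (perm_others2 lk)) cfold_cons cfold_shifted.
rewrite (cfold_perm _ _ (perm_others2 kl)) cfold_cons.
rewrite (cfold_perm _ _ (perm_others2C kl)) cfold_shifted -!/(pairing u l k (X n) _ _).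
rewrite /shifted direction_l direction_k !pairingDl -/(shifted s) margin_shifted (pairingC n b a); ring.
Qed.

(** The sum is the second derivative of the loss along [direction]. The Lipschitz bound on the
    gradient caps it by [beta] times the squared norm of [direction], and [eta < beta^-1]. *)
Lemma step_curvature eta : step_ok (lossu X y) u eta ->
  eta * (\sum_(n < N) expR (- margin u n) * (p1 n ^+ 2 - 2 * p2 n)) <=
  \sum_d a d ^+ 2 + \sum_d b d ^+ 2.
Proof.
case=> eta0 [r [beta [r0 [beta0 [eb lip]]]]].
set A := _ + _.
have A0 : 0 <= A by rewrite addr_ge0 ?sumr_ge0// => i _; rewrite sqr_ge0.
have dirA : \sum_i \sum_d direction i d ^+ 2 = A.
  have kl : k != l by rewrite eq_sym.
  rewrite (bigD1 l)//= (bigD1 k kl)/= [X in _ + (_ + X)]big1 ?addr0 ?direction_l ?direction_k//.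
  move=> i /andP[/negbTE il /negbTE ik]; apply: big1 => d _.
  by rewrite /direction il ik expr0n.
have sqrA s : \sum_i \sum_d (shifted s i d - u i d) ^+ 2 = s ^+ 2 * A.
  rewrite -dirA mulr_sumr; apply: eq_bigr => i _; rewrite mulr_sumr.
  by apply: eq_bigr => d _; rewrite /shifted; ring.
have sh0 : shifted 0 = u.
  by apply/funext => i; apply/funext => d; rewrite /shifted mul0r addr0.
suff : \sum_(n < N) expR (- margin u n) * (p1 n ^+ 2 - 2 * p2 n) <= beta * A.
  move=> h; apply: (le_trans (ler_wpM2l (ltW eta0) h)).
  rewrite mulrA -[leRHS]mul1r ler_wpM2r// -(mulVf (lt0r_neq0 beta0)).
  by rewrite ler_wpM2r// ltW.
(* For [s] below this bound, [s * Num.sqrt A < r] keeps [shifted s] in the Lipschitz ball; adding 1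
   avoids a zero denominator. *)
have e0 : 0 < r / (Num.sqrt A + 1).
  by rewrite divr_gt0// ltr_wpDl ?sqrtr_ge0.
apply: (is_derive_le e0 (is_derive_sum_quadratic_exp _ _ _)) => s /andP[s0 se].
rewrite -!grad_dir sh0 -sumrB.
under eq_bigr => i _ do rewrite -sumrB.
under eq_bigr => i _ do under eq_bigr => d _ do rewrite -mulrBl.
set g := fun i d => gradu (lossu X y) (shifted s) i d - gradu (lossu X y) u i d.
have : \sum_i \sum_d g i d ^+ 2 <= (beta * s) ^+ 2 * A.
  have pg0 (v : 'I_L -> 'I_D -> R) : 0 <= \sum_i \sum_d v i d ^+ 2.
    by apply: sumr_ge0 => i _; apply: sumr_ge0 => d _; rewrite sqr_ge0.
  have := lip (shifted s) u; rewrite /pnorm sqrA sqrtrM ?sqr_ge0// sqrtr_sqr gtr0_norm//.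
  have -> : Num.sqrt (\sum_i \sum_d (u i d - u i d) ^+ 2) = 0.
    rewrite big1 ?sqrtr0// => i _; rewrite big1// => d _.
    by rewrite subrr expr0n.
  have sA : s * Num.sqrt A < r.
    move: se; rewrite ltr_pdivlMr ?ltr_wpDl ?sqrtr_ge0//; apply: le_lt_trans.
    by rewrite ler_pM2l// lerDl.
  move=> /(_ sA r0) h.
  rewrite -(sqr_sqrtr (pg0 g)) -(sqr_sqrtr A0) -exprMn ler_sqr ?nnegrE ?sqrtr_ge0//.
    by rewrite -mulrA.
  by rewrite !mulr_ge0 ?sqrtr_ge0// ltW.
move=> hg.
have bs : 0 < beta * s by rewrite mulr_gt0.
(* AM-GM with weight [beta * s] *)
have amgm i d : g i d * direction i d <=
    (beta * s)^-1 / 2 * g i d ^+ 2 + beta * s / 2 * direction i d ^+ 2.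
  rewrite -subr_ge0.
  have -> : (beta * s)^-1 / 2 * g i d ^+ 2 + beta * s / 2 * direction i d ^+ 2 -
     g i d * direction i d = (beta * s)^-1 / 2 * (g i d - beta * s * direction i d) ^+ 2.
    by field; rewrite !lt0r_neq0.
  by rewrite mulr_ge0 ?sqr_ge0// divr_ge0// invr_ge0 ltW.
apply: (@le_trans _ _ (\sum_i \sum_d
    ((beta * s)^-1 / 2 * g i d ^+ 2 + beta * s / 2 * direction i d ^+ 2))).
  by apply: ler_sum => i _; apply: ler_sum => d _; exact: amgm.
under eq_bigr => i _ do rewrite big_split /= -!mulr_sumr.
rewrite big_split /= -!mulr_sumr dirA.
apply: (@le_trans _ _ ((beta * s)^-1 / 2 * ((beta * s) ^+ 2 * A) + beta * s / 2 * A)).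
  by rewrite lerD2r ler_wpM2l// divr_ge0// invr_ge0 ltW.
rewrite le_eqVlt; apply/orP; left; apply/eqP.
by field; rewrite !lt0r_neq0.
Qed.

End TwoLayers.

Section StepBounds.
Variables (u : 'I_L -> 'I_D -> R) (l k : 'I_L) (eta : R).
Hypotheses (lk : l != k) (step : step_ok (lossu X y) u eta).
Notation h := (cfold u (others2 l k) (residual u)).

Let eta_gt0 : 0 < eta. Proof. by case: step. Qed.

(** Dropping the nonnegative square [p1 n ^+ 2] from the curvature bound leaves the mixed term,
    which is linear in the residual. *)
Lemma step_dotp_cconv a b :
  - (2 * eta * dotp (cconv h a) b) <= \sum_d a d ^+ 2 + \sum_d b d ^+ 2.
Proof.
apply: le_trans (step_curvature a b lk step).
have -> : dotp (cconv h a) b = \sum_(n < N) expR (- margin u n) * (y n * pairing u l k (X n) a b).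
  rewrite cfold_suml cconv_suml (dotp_suml _ (fun n d => _ * cconv _ a d)).
  by apply: eq_bigr => n _; rewrite dotpZl mulrA.
rewrite [X in - X]mulrAC -mulNr mulrC ler_pM2l// mulr_sumr -sumrN.
apply: ler_sum => n _; have := expR_ge0 (- margin u n); set e := expR _ => e0.
have : 0 <= e * (y n * (pairing u l k (X n) (u k) a + pairing u l k (X n) (u l) b)) ^+ 2.
  by rewrite mulr_ge0// sqr_ge0.
lra.
Qed.

(** Taking [b = - eta * cconv h a] makes the left side of the previous bound twice the square that
    appears on its right. *)
Lemma step_cconv_norm a : eta ^+ 2 * \sum_d cconv h a d ^+ 2 <= \sum_d a d ^+ 2.
Proof.
have := step_dotp_cconv a (fun d => - eta * cconv h a d).
rewrite dotpZr; under [X in _ <= _ + X]eq_bigr do rewrite exprMn.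
have -> : dotp (cconv h a) (cconv h a) = \sum_d cconv h a d ^+ 2.
  by apply: eq_bigr => d _; rewrite expr2.
rewrite -mulr_sumr sqrrN; set S := \sum_d cconv h a d ^+ 2; set A := \sum_d _.
lra.
Qed.

(* Summing the norm bound over the cosine and sine vectors of frequency [d]. *)
Lemma step_dftc d : eta ^+ 2 * nsq (dftc h d) <= 1.
Proof.
pose t (j : 'I_D) : R := 2 * pi * (j * d)%N%:R / D%:R.
have := lerD (step_cconv_norm (fun j => cos (t j))) (step_cconv_norm (fun j => sin (t j))).
rewrite -mulrDr -!big_split /=.
under [X in _ <= X]eq_bigr do rewrite cos2Dsin2.
(* At each [j] the two convolutions are, up to sign, the real and imaginary parts of [dftc h d]
   times a unit, so every summand is the same. *)
rewrite (eq_bigr (fun=> nsq (dftc h d))); last first.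
  move=> j _; transitivity (nsq (cj (chi R D' (j * d)) * dftc h d)); last first.
    by rewrite nsqM nsq_conj nsq_chi mul1r.
  rewrite dftcE mulrCA mulr_sumr.
  have -> : \sum_(i < D) cj (chi R D' (j * d)) * ((h i)%:C * chi R D' (i * d)) =
    (\sum_(i < D) cos (t i) * h (j + i)) +i* - (\sum_(i < D) sin (t i) * h (j + i)).
    rewrite (reindex_inj (addrI j)) -sumrN; elim/big_rec3: _ => [//|i z1 z2 z3 _ ->].
    rewrite chi_addl.
    have -> : cj (chi R D' (j * d)) * ((h (j + i))%:C * (chi R D' (j * d) * chi R D' (i * d))) =
      (h (j + i))%:C * chi R D' (i * d).
      rewrite -[RHS]mulr1 -(chi_conj R D' (j * d)); ring.
    rewrite /chi -/(t i); apply/eqP; rewrite eq_complex /=.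
    by apply/andP; split; apply/eqP; ring.
  rewrite !cconvE nsqM nsq_real /nsq; ring.
by rewrite !sumr_const card_ord mulrnAr lerMn2r.
Qed.

Variable u' : 'I_L -> 'I_D -> R.
Hypothesis gd : forall l d, u' l d = u l d - eta * gradu (lossu X y) u l d.

Lemma gd_cfold i : u' i = fun d => u i d + eta * cfold u (others i) (residual u) d.
Proof. by apply/funext => d; rewrite gd graduE mulrN opprK. Qed.

Lemma dftc_gd i d : dftc (u' i) d =
  dftc (u i) d + eta%:C * dftc (cfold u (others i) (residual u)) d.
Proof. by rewrite gd_cfold dftcD dftcZ. Qed.

(** With a, b the two modes and c the mode of [h], the updates are a + eta c conj(b) and b + eta c
    conj(a). Their cross terms in the squared moduli agree and cancel in the difference. *)
Lemma gd_balance d :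
  nsq (dftc (u' l) d) - nsq (dftc (u' k) d) =
  (nsq (dftc (u l) d) - nsq (dftc (u k) d)) * (1 - eta ^+ 2 * nsq (dftc h d)).
Proof.
have kl : k != l by rewrite eq_sym.
rewrite !dftc_gd (cfold_perm _ _ (perm_others2 lk)) (cfold_perm _ _ (perm_others2 kl)).
rewrite (@cfold_cons _ _ _ _ (others2 k l)) (cfold_perm _ _ (perm_others2C kl)).
rewrite cfold_cons !dftc_cconv; move: (dftc (u l) d) (dftc (u k) d) (dftc h d).
by move=> [a1 a2] [b1 b2] [c1 c2]; rewrite /nsq /cj /=; ring.
Qed.

Lemma gd_balance_le d :
  `|nsq (dftc (u' l) d) - nsq (dftc (u' k) d)| <=
  `|nsq (dftc (u l) d) - nsq (dftc (u k) d)|.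
Proof.
rewrite gd_balance normrM ler_piMr// ler_norml; have := step_dftc d.
have : 0 <= eta ^+ 2 * nsq (dftc h d) by rewrite mulr_ge0 ?sqr_ge0 ?nsq_ge0.
by move=> ? ?; apply/andP; split; lra.
Qed.

End StepBounds.
End Loss.

(** * Null sets *)

Section NullSets.
Variables (R : realType) (T : finType) (i0 : T).
Implicit Types A B : set (T -> R).

Lemma box_vol_ge0 (a b : T -> R) : (forall i, a i <= b i) -> 0 <= box_vol a b.
Proof. by move=> ab; apply: prodr_ge0 => i _; rewrite subr_ge0. Qed.

(** The coordinate [i0] matters: without coordinates the empty product would be 1. *)
Lemma box_vol_point (a : T -> R) : box_vol a a = 0.
Proof. by rewrite /box_vol (bigD1 i0)//= subrr mul0r. Qed.

Lemma null_set0 : Defs.null_set (@set0 (T -> R)).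
Proof.
move=> eps e0; exists (fun _ _ => 0), (fun _ _ => 0); split => //; split => // n.
by rewrite big1 ?ltW// => k _; rewrite box_vol_point.
Qed.

Lemma sum_subset (I : eqType) (s s' : seq I) (F : I -> R) :
  (forall i, 0 <= F i) -> uniq s -> {subset s <= s'} ->
  \sum_(i <- s) F i <= \sum_(i <- s') F i.
Proof.
move=> F0; elim: s s' => [|x s IH] s' /=; first by rewrite big_nil sumr_ge0.
move=> /andP[xs us] ss'; have xs' : x \in s' by rewrite ss' ?mem_head.
rewrite big_cons (perm_big _ (perm_to_rem xs')) big_cons lerD2l; apply: IH => //.
move=> z zs; have := ss' z; rewrite inE zs orbT => /(_ isT).
rewrite (perm_mem (perm_to_rem xs')) inE => /orP[/eqP zx|//].
by rewrite -zx zs in xs.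
Qed.

Lemma sum_geometric_half_le (n : nat) : \sum_(k < n) (2^-1 : R) ^+ k.+1 <= 1.
Proof.
suff -> : \sum_(k < n) (2^-1 : R) ^+ k.+1 = 1 - 2^-1 ^+ n.
  by rewrite gerBl exprn_ge0// invr_ge0.
elim: n => [|n IH]; first by rewrite big_ord0 expr0 subrr.
by rewrite big_ord_recr /= IH exprS; field.
Qed.

(** The [m]-th set is covered with total volume [eps * 2^-1 ^+ m.+1], and the double family of boxes
    is enumerated through codes of pairs. *)
Lemma null_set_bigcup (A : nat -> set (T -> R)) :
  (forall m, Defs.null_set (A m)) -> Defs.null_set (\bigcup_m A m).
Proof.
move=> nA eps e0.
have /choice[a /choice[b ab]] : forall m, exists a, exists b : nat -> T -> R,
    (forall k i, a k i <= b k i) /\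
    (forall f, A m f -> exists k, forall i, a k i <= f i <= b k i) /\
    (forall n, \sum_(k < n) box_vol (a k) (b k) <= eps * 2^-1 ^+ m.+1).
  by move=> m; apply: nA; rewrite mulr_gt0// exprn_gt0// invr_gt0.
(* A number coding no pair yields the degenerate box at the origin, of volume 0. *)
pose get (c : nat -> nat -> T -> R) k : T -> R :=
  if @pickle_inv (nat * nat)%type k is Some p then c p.1 p.2 else fun=> 0.
exists (get a), (get b); split; [|split].
- move=> k i; rewrite /get; case: pickle_inv => [p|//].
  by have [] := ab p.1.
- move=> f [m _ Af]; have [_ [cov _]] := ab m; have [k hk] := cov f Af.
  by exists (pickle (m, k)) => i; rewrite /get pickleK_inv.
move=> n; pose F (p : nat * nat) := box_vol (a p.1 p.2) (b p.1 p.2).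
have F0 p : 0 <= F p by apply: box_vol_ge0; have [] := ab p.1.
pose s := pmap (@pickle_inv (nat * nat)%type) (iota 0 n).
have -> : \sum_(k < n) box_vol (get a k) (get b k) = \sum_(p <- s) F p.
  rewrite -(big_mkord xpredT (fun k => box_vol (get a k) (get b k))) /index_iota subn0 /s.
  elim: (iota 0 n) => [|k r IH] /=; first by rewrite !big_nil.
  rewrite big_cons IH /get; case: pickle_inv => [p|] /=; first by rewrite big_cons.
  by rewrite box_vol_point add0r.
have us : uniq s by rewrite (pmap_uniq (@pickle_invK _)) ?iota_uniq.
(* The pairs coded below [n] lie in a square of side [M], over which the sum can be taken row by
   row. *)
have [M hM] : exists M, forall p, p \in s -> (p.1 < M)%N && (p.2 < M)%N.
  exists (\max_(p <- s) maxn p.1 p.2).+1 => p ps; rewrite !ltnS -geq_max.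
  exact: leq_bigmax_seq.
apply: (@le_trans _ _ (\sum_(p <- [seq (m, k) | m <- iota 0 M, k <- iota 0 M]) F p)).
  apply: sum_subset => // -[m k] /hM/andP[mM kM].
  by apply: allpairs_f; rewrite mem_iota.
have iM : iota 0 M = index_iota 0 M by rewrite /index_iota subn0.
rewrite big_allpairs.
apply: (@le_trans _ _ (\sum_(m <- iota 0 M) eps * 2^-1 ^+ m.+1)).
  apply: ler_sum => m _; have [_ [_ hs]] := ab m; apply: le_trans (hs M).
  by rewrite iM big_mkord.
rewrite iM big_mkord -mulr_sumr.
by rewrite -[leRHS]mulr1 ler_wpM2l ?sum_geometric_half_le// ltW.
Qed.

Lemma null_set_bigcup_count (I : countType) (A : I -> set (T -> R)) :
  (forall i, Defs.null_set (A i)) -> Defs.null_set (\bigcup_i A i).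
Proof.
move=> nA; pose A' k := if @unpickle I k is Some i then A i else set0.
have /null_set_bigcup nA' : forall m, Defs.null_set (A' m).
  by move=> m; rewrite /A'; case: unpickle => [i|]; [exact: nA|exact: null_set0].
move=> eps /nA'[a [b [ab [cov vol]]]]; exists a, b; split=> //; split=> //.
move=> f [i _ Af]; apply: cov; exists (pickle i) => //.
by rewrite /A' pickleK.
Qed.

(** Cells are closed on both sides so that the endpoint [K%:R] falls in the last one. *)
Lemma nat_floor_bounded (K : nat) (x : R) : (0 < K)%N -> 0 <= x <= K%:R ->
  exists p : 'I_K, p%:R <= x <= p%:R + 1.
Proof.
elim: K => [//|K IH] _ /andP[x0 xK].
have [xK'|Kx] := lerP x K%:R; last first.
  by exists ord_max; rewrite /= (ltW Kx) natr1.
case: K IH xK xK' => [|K] IH xK xK'.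
  by exists ord0; rewrite /= x0 add0r (le_trans xK').
have [|p hp] := IH isT; first by rewrite x0.
by exists (widen_ord (leqnSn _) p).
Qed.

(* Cover the graph by boxes over a grid of the coordinates other than [i0]. *)
Lemma null_set_graph (M : R) A : 0 < M ->
  (forall f i, A f -> `|f i| <= M) ->
  (forall e, 0 < e -> exists2 h, 0 < h & forall f g, A f -> A g ->
     (forall i, i != i0 -> `|f i - g i| <= h) -> `|f i0 - g i0| <= e) ->
  Defs.null_set A.
Proof.
move=> M0 AM Auc eps e0.
pose I' : finType := {i : T | i != i0}.
pose c := #|[pred i | i != i0]|.
have cI' : #|I'| = c by rewrite card_sig.
have M2 : 0 < (2 * M) ^+ c by rewrite exprn_gt0// mulr_gt0.
(* The grid has [K ^ c] cells of side [2 * M / K] and each box has height [2 * e], so the total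
   volume is [2 * e * (2 * M) ^+ c], that is [eps]. *)
pose e := eps / (2 * (2 * M) ^+ c).
have ee0 : 0 < e by rewrite divr_gt0// mulr_gt0.
have [h h0 hA] := Auc e ee0.
have [K K0 hK] : exists2 K, (0 < K)%N & 2 * M / K%:R <= h.
  exists (Num.truncn (2 * M / h)).+1 => //.
  rewrite ler_pdivrMr ?ltr0n// [leRHS]mulrC -ler_pdivrMr//.
  by rewrite ltW// truncnS_gt.
have KR : 0 < K%:R :> R by rewrite ltr0n.
pose w := 2 * M / K%:R.
have w0 : 0 < w by rewrite divr_gt0// mulr_gt0.
pose J : finType := {ffun I' -> 'I_K}.
pose cell (j : J) : set (T -> R) :=
  [set f | forall i : I', - M + w * (j i)%:R <= f (val i) <= - M + w * (j i)%:R + w].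
(* A point of [A] over the cell, whose height centres the box; the default serves the cells that
   miss [A]. *)
pose pt (j : J) := xget (fun=> 0) (A `&` cell j).
pose lo (j : J) i := if insub i is Some i' then - M + w * (j i')%:R else pt j i0 - e.
pose hi (j : J) i := if insub i is Some i' then - M + w * (j i')%:R + w else pt j i0 + e.
pose get (b : J -> T -> R) (k : nat) : T -> R :=
  if @insub nat (fun k => k < #|J|)%N 'I_(#|J|) k is Some k' then b (enum_val k') else fun=> 0.
have lohi j i : lo j i <= hi j i.
  by rewrite /lo /hi; case: insub => [i'|]; lra.
have vol j : box_vol (lo j) (hi j) = 2 * e * w ^+ c.
  rewrite /box_vol (bigD1 i0)//= /lo /hi insubN ?eqxx//; congr (_ * _); first by lra.
  rewrite -prodr_const; apply: eq_bigr => i ii0.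
  by rewrite insubT; lra.
exists (get lo), (get hi); split; [|split].
- by move=> k i; rewrite /get; case: insub.
- move=> f Af.
  have /choice[j0 hj0] : forall i : I', exists p : 'I_K,
      - M + w * p%:R <= f (val i) <= - M + w * p%:R + w.
    move=> i; have := AM f (val i) Af; rewrite ler_norml => /andP[f1 f2].
    have [|p /andP[p1 p2]] := @nat_floor_bounded K ((f (val i) + M) / w) K0.
      apply/andP; split; first by apply: divr_ge0; [lra|exact: ltW].
      by rewrite ler_pdivrMr// /w mulrC divfK ?gt_eqF//; lra.
    exists p; move: p1 p2; rewrite ler_pdivlMr// ler_pdivrMr//.
    by move=> ? ?; apply/andP; split; lra.
  pose j : J := [ffun i => j0 i].
  have fj : cell j f by move=> i; rewrite ffunE.
  have [Apt cpt] : (A `&` cell j) (pt j) by apply: (@xgetPex _ _ (A `&` cell j)); exists f.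
  have jJ : (enum_rank j < #|J|)%N by [].
  exists (enum_rank j) => i; rewrite /get insubT /= /lo /hi.
  have -> : enum_val (Sub (nat_of_ord (enum_rank j)) jJ) = j.
    rewrite -[RHS]enum_rankK; congr enum_val; exact: val_inj.
  case: insubP => [i' _ <-|]; first exact: fj.
  rewrite negbK => /eqP ->.
  have : `|f i0 - pt j i0| <= e.
    apply: hA => // i1 ii1; have := fj (Sub i1 ii1); have := cpt (Sub i1 ii1) => /=.
    move=> /andP[? ?] /andP[? ?]; rewrite ler_norml; rewrite -/w in hK.
    by apply/andP; split; lra.
  by rewrite ler_norml => /andP[? ?]; apply/andP; split; lra.
move=> n.
have cnt (V : R) (q : nat) : 0 <= V -> \sum_(k < n) (if (k < q)%N then V else 0) <= V * q%:R.
  move=> V0; suff -> : \sum_(k < n) (if (k < q)%N then V else 0) = V * (minn n q)%:R.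
    by rewrite ler_wpM2l// ler_nat geq_minr.
  elim: (n) => [|m IH]; first by rewrite big_ord0 min0n mulr0.
  rewrite big_ord_recr /= IH; case: ltnP => mJ.
    by rewrite (minn_idPl mJ) -natr1; ring.
  by rewrite (minn_idPr (leqW mJ)) addr0.
apply: (@le_trans _ _ (\sum_(k < n) (if (k < #|J|)%N then 2 * e * w ^+ c else 0))).
  apply: ler_sum => k _; rewrite /get.
  case: (@insubP nat (fun k => k < #|J|)%N 'I_(#|J|) k) => [k' -> _|/negbTE ->].
    by rewrite vol.
  by rewrite box_vol_point.
apply: le_trans (cnt _ _ _) _; first by apply: mulr_ge0; [apply: mulr_ge0 => //; exact: ltW|apply: exprn_ge0; exact: ltW].
rewrite card_ffun card_ord cI' natrX -mulrA -exprMn /w divfK ?gt_eqF//.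
by rewrite /e le_eqVlt; apply/orP; left; apply/eqP; field; rewrite gt_eqF.
Qed.

End NullSets.

(** * Initialisations with two layers of equal modulus at some frequency *)

Section BalancedNull.
Variables (R : realType) (L D' : nat).
Notation D := D'.+1.
Notation q := (Num.sqrt (D%:R : R)).

Lemma trig_sum_le (x c : 'I_D -> R) (h : R) : (forall p, `|x p| <= h) ->
  (forall p, `|c p| <= 1) -> `|q^-1 * \sum_p x p * c p| <= q * h.
Proof.
move=> xh c1; rewrite normrM ger0_norm ?invr_ge0 ?sqrtr_ge0//.
rewrite ler_pdivrMl ?sqrtD_gt0// mulrA -expr2 sqr_sqrtr ?ler0n//.
apply: le_trans (ler_norm_sum _ _ _) _.
apply: (@le_trans _ _ (\sum_(p < D) h)); last by rewrite sumr_const card_ord mulr_natl.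
apply: ler_sum => p _; rewrite normrM -[leRHS]mulr1 ler_pM//.
Qed.

Lemma dist_sqr_le (x y B t : R) : `|x| <= B -> `|y| <= B -> `|x - y| <= t ->
  `|x ^+ 2 - y ^+ 2| <= 2 * B * t.
Proof.
move=> xB yB xyt; rewrite subr_sqr normrM mulrC ler_pM//.
by apply: le_trans (ler_normD _ _) _; lra.
Qed.

(** For [x] and [y] of the same sign, [x - y] is at most [x + y] in absolute value. This recovers a
    value from its square, with a square-root modulus of continuity. *)
Lemma sqr_dist_le (x y : R) : 0 <= x * y -> (x - y) ^+ 2 <= `|x ^+ 2 - y ^+ 2|.
Proof.
move=> xy; rewrite subr_sqr normrM -real_normK ?num_real// expr2 ler_wpM2l//.
rewrite -ler_sqr ?nnegrE// !real_normK ?num_real//.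
rewrite -subr_ge0 (_ : _ - _ = 4 * (x * y)); first by rewrite mulr_ge0.
ring.
Qed.

(** Fixing an integer bound on the entries, the frequency and the sign of the real part of
    [dftc (u l) d] cuts the set into countably many pieces. On a piece the equation determines that
    real part by a square root. The entry [(l, ord0)] enters the real part with weight cos 0 = 1 and
    the imaginary part with sin 0 = 0, so it is a uniformly continuous function of the other
    entries, and the piece is a graph. *)
Lemma null_set_balanced (l k : 'I_L) : l != k ->
  null_set2 [set u : 'I_L -> 'I_D -> R |
    exists d, nsq (dftc (u l) d) = nsq (dftc (u k) d)].
Proof.
move=> lk; rewrite /null_set2.
pose T : finType := ('I_L * 'I_D)%type.
pose row (i : 'I_L) (f : T -> R) j := f (i, j).
pose A (w : nat * 'I_D * bool) : set (T -> R) := [set f |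
  [/\ forall i, `|f i| <= w.1.1.+1%:R,
     nsq (dftc (row l f) w.1.2) = nsq (dftc (row k f) w.1.2) &
     if w.2 then 0 <= (dft (row l f) w.1.2).1 else (dft (row l f) w.1.2).1 <= 0]].
pose i0 : T := (l, ord0).
suff nA w : Defs.null_set (A w).
  have := null_set_bigcup_count i0 nA => {nA} + eps e0.
  move=> /(_ eps e0) [a [b [ab [cov vol]]]]; exists a, b; split=> //; split=> //.
  move=> f [d fd]; apply: cov.
  pose M := Num.truncn (\sum_i `|f i|).
  exists (M, d, 0 <= (dft (row l f) d).1) => //; split=> //=; last first.
    by case: ifP => // /negbT; rewrite -ltNge => /ltW.
  move=> i; rewrite ltW//; apply: le_lt_trans (truncnS_gt _).
  by rewrite (bigD1 i)//= lerDl sumr_ge0.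
case: w => -[m d] b; rewrite /A /=.
have m0 : 0 < m.+1%:R :> R by rewrite ltr0n.
apply: (@null_set_graph _ _ i0 m.+1%:R) => // [f i [+ _ _]|e e0]; first exact.
set B : R := m.+1%:R in m0 *.
have q0 := @sqrtD_gt0 R D'; have qq : q ^+ 2 = D%:R by rewrite sqr_sqrtr ?ler0n.
have D0 : 0 < D%:R :> R by rewrite ltr0n.
(* The target [e] is split in two: [hh2] controls the square root of the error in the three other
   squares, [hh1] the remaining entries of row [l]. *)
pose h := Num.min B (Num.min (e / (2 * D%:R)) (e ^+ 2 / (24 * D%:R ^+ 2 * B))).
have h0 : 0 < h.
  by rewrite !lt_min m0 !divr_gt0 ?mulr_gt0 ?exprn_gt0.
have hh1 : D%:R * h <= e / 2.
  have : h <= e / (2 * D%:R) by rewrite !ge_min lexx orbT.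
  by rewrite ler_pdivlMr ?mulr_gt0//; lra.
have hh2 : 6 * D%:R * B * h <= (e / (2 * q)) ^+ 2.
  have : h <= e ^+ 2 / (24 * D%:R ^+ 2 * B) by rewrite !ge_min lexx !orbT.
  rewrite exprMn exprVn exprMn qq !ler_pdivlMr ?mulr_gt0 ?exprn_gt0//; lra.
exists h => // f g [fB fe fs] [gB ge gs] fg.
pose c (p : 'I_D) : R := cos (2 * pi * (p * d)%N%:R / D%:R).
pose s (p : 'I_D) : R := sin (2 * pi * (p * d)%N%:R / D%:R).
have c1 p : `|c p| <= 1 by exact: cos_max.
have s1 p : `|s p| <= 1 by exact: sin_max.
pose lin (v x : 'I_D -> R) := q^-1 * \sum_p x p * v p.
have linB v x z : lin v x - lin v z = lin v (fun p => x p - z p).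
  by rewrite /lin -mulrBr -sumrB; congr (_ * _); apply: eq_bigr => p _; rewrite mulrBl.
pose x0 (x : 'I_D -> R) p := if p == ord0 then 0 else x p.
have lin0 v x : lin v x = q^-1 * (x ord0 * v ord0) + lin v (x0 x).
  rewrite /lin -mulrDr; congr (_ * _); rewrite (bigD1 ord0)//= [in RHS](bigD1 ord0)//=.
  rewrite /x0 eqxx mul0r add0r; congr (_ + _); apply: eq_bigr => p /negbTE p0.
  by rewrite p0.
have cs0 : c ord0 = 1 by rewrite /c mul0n mulr0 mul0r cos0.
have ss0 : s ord0 = 0 by rewrite /s mul0n mulr0 mul0r sin0.
have nsqE x : nsq (dftc x d) = lin c x ^+ 2 + lin s x ^+ 2.
  by rewrite /nsq /dftc /dft /= sqrrN.
have dk v : (forall p, `|v p| <= 1) -> `|lin v (row k f) - lin v (row k g)| <= q * h.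
  move=> v1; rewrite linB; apply: trig_sum_le => // p; apply: fg.
  by rewrite /i0 xpair_eqE (eq_sym k) (negbTE lk).
have dl v : (forall p, `|v p| <= 1) ->
    `|lin v (x0 (row l f)) - lin v (x0 (row l g))| <= q * h.
  move=> v1; rewrite linB; apply: trig_sum_le => // p; rewrite /x0.
  case: eqP => [|/eqP] p0; first by rewrite subrr normr0 ltW.
  by apply: fg; rewrite /i0 xpair_eqE (negbTE p0) andbF.
have bd v i (f' : T -> R) : (forall j, `|f' j| <= B) -> (forall p, `|v p| <= 1) ->
    `|lin v (row i f')| <= q * B.
  by move=> f'B v1; apply: trig_sum_le => // p; exact: f'B.
move: fe ge; rewrite !nsqE => fe ge.
have sl : `|lin s (row l f) - lin s (row l g)| <= q * h.
  by rewrite (lin0 s (row l f)) (lin0 s (row l g)) ss0 !mulr0 !add0r; exact: dl.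
have e1 := dist_sqr_le (bd c k f fB c1) (bd c k g gB c1) (dk c c1).
have e2 := dist_sqr_le (bd s k f fB s1) (bd s k g gB s1) (dk s s1).
have e3 := dist_sqr_le (bd s l f fB s1) (bd s l g gB s1) sl.
have ss : 0 <= lin c (row l f) * lin c (row l g).
  move: fs gs; rewrite /dft /= -/(lin c (row l f)) -/(lin c (row l g)).
  by case: (b) => ? ?; [exact: mulr_ge0|exact: mulr_le0].
have cl : `|lin c (row l f) - lin c (row l g)| <= e / (2 * q).
  have e2q : 0 <= e / (2 * q) by rewrite ltW// divr_gt0// mulr_gt0.
  rewrite -ler_sqr ?nnegrE//.
  rewrite real_normK ?num_real//; apply: le_trans (sqr_dist_le ss) _.
  apply: le_trans hh2.
  have -> : 6 * D%:R * B * h = 2 * (q * B) * (q * h) + 2 * (q * B) * (q * h) + 2 * (q * B) * (q * h).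
    by rewrite -[in LHS]qq; ring.
  move: e1 e2 e3; rewrite !ler_norml => /andP[? ?] /andP[? ?] /andP[? ?].
  by apply/andP; split; lra.
have := dl c c1; have := cl; rewrite (lin0 c (row l f)) (lin0 c (row l g)) cs0 !mulr1.
have -> : f i0 - g i0 = q * (q^-1 * row l f ord0 - q^-1 * row l g ord0).
  by rewrite -mulrBr mulrA mulfV ?gt_eqF// mul1r.
set a := lin c (x0 _); set a' := lin c (x0 _); set r1 := _ * row l f _; set r2 := _ * _ => k1 k2.
have : `|r1 - r2| <= e / (2 * q) + q * h.
  have -> : r1 - r2 = (r1 + a - (r2 + a')) - (a - a') by ring.
  by apply: le_trans (ler_normB _ _) _; exact: lerD.
rewrite normrM (gtr0_norm q0) -(ler_pM2l q0) => /le_trans; apply.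
have -> : q * (e / (2 * q) + q * h) = e / 2 + q ^+ 2 * h by field; rewrite gt_eqF.
by rewrite qq; lra.
Qed.

End BalancedNull.

(** * Limits *)

Section RealLimits.
Variable R : realType.

Lemma cvg_sumr (T I : Type) (F : set_system T) {FF : Filter F} (r : seq I)
    (f : I -> T -> R) (a : I -> R) :
  (forall i, f i t @[t --> F] --> a i) ->
  \sum_(i <- r) f i t @[t --> F] --> \sum_(i <- r) a i.
Proof.
move=> fa; elim: r => [|i r IH].
  rewrite big_nil (_ : (fun t => _) = cst 0); first exact: cvg_cst.
  by apply/funext => t; rewrite big_nil.
rewrite big_cons (_ : (fun t => _) = (fun t => f i t + \sum_(j <- r) f j t)).
  exact: cvgD.
by apply/funext => t; rewrite big_cons.
Qed.

Lemma cvg_sqr (T : Type) (F : set_system T) {FF : Filter F} (f : T -> R) (a : R) :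
  f t @[t --> F] --> a -> f t ^+ 2 @[t --> F] --> a ^+ 2.
Proof. by move=> fa; rewrite expr2; under eq_fun do rewrite expr2; exact: cvgM. Qed.

Lemma cvg_sqrt (T : Type) (F : set_system T) {FF : Filter F} (f : T -> R) (a : R) :
  f t @[t --> F] --> a -> Num.sqrt (f t) @[t --> F] --> Num.sqrt a.
Proof. by move=> fa; apply: (cvg_comp _ Num.sqrt fa); exact: sqrt_continuous. Qed.

Lemma cvgr_eq_lim (T : Type) (F : set_system T) {FF : ProperFilter F}
    (f g : T -> R) (a b : R) :
  f t @[t --> F] --> a -> g t @[t --> F] --> b ->
  (\forall t \near F, f t = g t) -> a = b.
Proof.
move=> fa gb fg.
have fb : f t @[t --> F] --> b.
  by apply: cvg_trans gb; apply: near_eq_cvg; apply: filterS fg => t ->.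
exact: (norm_cvg_unique fa fb).
Qed.

(** Compactness of the segment gives a cluster point, and an ultrafilter converges to each of its
    cluster points. *)
Lemma bounded_cvg_ultra (T : Type) (U : set_system T) {FU : UltraFilter U}
    (f : T -> R) (a b : R) :
  (\forall t \near U, a <= f t <= b) -> exists l : R, f t @[t --> U] --> l.
Proof.
move=> fab; have FP : ProperFilter U by exact: ultra_proper.
have Ff : ProperFilter (f @ U) by exact: fmap_proper_filter.
have [|l [_ cl]] := @segment_compact R a b (f @ U) Ff.
  by rewrite /nbhs /= /fmap /=; apply: filterS fab => t; rewrite /= in_itv.
exists l => B Bl; have [//|UC] := in_ultra_setVsetC (f @^-1` B) FU.
by have [t []] := cl (~` B) B UC Bl.
Qed.

(** The terms before [T0] contribute a fixed amount [K], eventually negligible against the diverging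
    total weight; the later ones deviate by at most [e / 2]. *)
Lemma weighted_cesaro (c g : nat -> R) (G : R) : (forall t, 0 <= c t) ->
  \sum_(0 <= t < n) c t @[n --> \oo] --> +oo ->
  g t @[t --> \oo] --> G ->
  (\sum_(0 <= t < n) c t * g t) / (\sum_(0 <= t < n) c t) @[n --> \oo] --> G.
Proof.
move=> c0 /cvgryPgt Coo /cvgrPdist_le gG; apply/cvgrPdist_le => e e0.
have e20 : 0 < e / 2 by rewrite divr_gt0.
have [T0 _ hT0] := gG _ e20.
pose K := \sum_(0 <= t < T0) c t * `|G - g t|.
have K0 : 0 <= K by apply: sumr_ge0 => t _; rewrite mulr_ge0.
have C0 := Coo 0; have CK := Coo (K / (e / 2)).
near=> n.
have Cn : 0 < \sum_(0 <= t < n) c t by near: n.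
have Kn : K / (e / 2) < \sum_(0 <= t < n) c t by near: n.
have T0n : (T0 <= n)%N by near: n; exact: nbhs_infty_ge.
have -> : G - (\sum_(0 <= t < n) c t * g t) / (\sum_(0 <= t < n) c t) =
    (\sum_(0 <= t < n) c t * (G - g t)) / (\sum_(0 <= t < n) c t).
  under [in RHS]eq_bigr do rewrite mulrBr.
  by rewrite sumrB -mulr_suml mulrBl mulrAC divff ?gt_eqF// mul1r.
rewrite normrM normfV (gtr0_norm Cn) ler_pdivrMr//.
apply: le_trans (ler_norm_sum _ _ _) _.
under eq_bigr do rewrite normrM ger0_norm ?c0//.
rewrite (big_cat_nat (leq0n T0) T0n)//= -/K.
apply: (@le_trans _ _ (K + e / 2 * \sum_(0 <= t < n) c t)).
  rewrite lerD2l (big_cat_nat (leq0n T0) T0n)//= mulrDr.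
  apply: (@le_trans _ _ (e / 2 * \sum_(T0 <= t < n) c t)); last first.
    by rewrite lerDr mulr_ge0 ?sumr_ge0// (ltW e20).
  rewrite mulr_sumr !big_nat; apply: ler_sum => t /andP[tT _].
  by rewrite mulrC ler_wpM2r// hT0.
move: Kn; rewrite ltr_pdivrMr//; set S := \sum_(0 <= t < n) c t; lra.
Unshelve. all: by end_near. Qed.

End RealLimits.

(** * Continuity of the network and of the Fourier transform *)

Section ConvLimits.
Variables (R : realType) (D' L : nat) (T : Type) (F : set_system T).
Context {FF : Filter F}.
Notation D := D'.+1.

Lemma cvg_cconv (h a : T -> 'I_D -> R) (hb ab : 'I_D -> R) :
  (forall d, h t d @[t --> F] --> hb d) -> (forall d, a t d @[t --> F] --> ab d) ->
  forall d, cconv (h t) (a t) d @[t --> F] --> cconv hb ab d.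
Proof.
move=> hh ha d; rewrite cconvE; under eq_fun do rewrite cconvE.
apply: cvgMl_tmp; apply: cvg_sumr => k; exact: cvgM.
Qed.

Lemma cvg_cfold (u : T -> 'I_L -> 'I_D -> R) (ub : 'I_L -> 'I_D -> R) s
    (x : T -> 'I_D -> R) (xb : 'I_D -> R) :
  (forall i d, u t i d @[t --> F] --> ub i d) ->
  (forall d, x t d @[t --> F] --> xb d) ->
  forall d, cfold (u t) s (x t) d @[t --> F] --> cfold ub s xb d.
Proof.
move=> hu hx; elim: s => [//|l s IH] d.
rewrite cfold_cons; under eq_fun do rewrite cfold_cons.
exact: cvg_cconv.
Qed.

Lemma cvg_fconv (u : T -> 'I_L -> 'I_D -> R) (ub : 'I_L -> 'I_D -> R) (x : 'I_D -> R) :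
  (0 < L)%N -> (forall i d, u t i d @[t --> F] --> ub i d) ->
  fconv (u t) x @[t --> F] --> fconv ub x.
Proof.
move=> L0 hu; rewrite fconv_enum//; under eq_fun do rewrite fconv_enum//.
by apply: cvgMl_tmp; apply: cvg_cfold => // d; exact: cvg_cst.
Qed.

Lemma cvg_dft (x : T -> 'I_D -> R) (xb : 'I_D -> R) d :
  (forall j, x t j @[t --> F] --> xb j) ->
  (dft (x t) d).1 @[t --> F] --> (dft xb d).1 /\
  (dft (x t) d).2 @[t --> F] --> (dft xb d).2.
Proof.
move=> hx; split; rewrite /dft /=.
  by apply: cvgMl_tmp; apply: cvg_sumr => p; exact: cvgMr_tmp.
by apply: cvgN; apply: cvgMl_tmp; apply: cvg_sumr => p; exact: cvgMr_tmp.
Qed.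

Lemma cvg_nsq_dftc (x : T -> 'I_D -> R) (xb : 'I_D -> R) d :
  (forall j, x t j @[t --> F] --> xb j) ->
  nsq (dftc (x t) d) @[t --> F] --> nsq (dftc xb d).
Proof. by move=> /(@cvg_dft _ _ d)[h1 h2]; apply: cvgD; exact: cvg_sqr. Qed.

End ConvLimits.

(** * Homogeneity of degree [L] *)

Section Homogeneity.
Variables (R : realType) (D' L : nat).
Notation D := D'.+1.
Implicit Types (u : 'I_L -> 'I_D -> R) (x : 'I_D -> R) (c : R).

Lemma cconvZl c h (a : 'I_D -> R) :
  cconv (fun d => c * h d) a = (fun d => c * cconv h a d).
Proof.
apply/funext => d; rewrite !cconvE [RHS]mulrCA; congr (_ * _).
by rewrite mulr_sumr; apply: eq_bigr => k _; rewrite mulrCA.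
Qed.

Lemma cfoldZ c b u s x : cfold (fun i d => c * u i d) s (fun d => b * x d) =
  (fun d => c ^+ size s * b * cfold u s x d).
Proof.
elim: s => [|l s IH]; first by apply/funext => d; rewrite expr0 mul1r.
rewrite cfold_cons IH cconvZr cconvZl; apply/funext => d.
by rewrite cfold_cons /= exprS; ring.
Qed.

Lemma size_others (l : 'I_L) : size (others l) = L.-1.
Proof. by rewrite size_rem ?mem_enum// size_enum_ord. Qed.

Lemma fconvZ c u x : (0 < L)%N -> fconv (fun i d => c * u i d) x = c ^+ L * fconv u x.
Proof.
move=> L0; rewrite !fconv_enum//.
have -> : x = fun d => 1 * x d by apply/funext => d; rewrite mul1r.
rewrite cfoldZ size_enum_ord mulr1 mulrCA; congr (_ * (_ * _)).
by congr (cfold _ _ _ _); apply/funext => d; rewrite mul1r.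
Qed.

End Homogeneity.

(** * Growth of two coupled Fourier modes *)

Section Growth.
(** Intended reading: at a frequency absent from the limit, [p] is the component of the product of
    the two modes along a fixed direction, [E] their energy and [q] their imbalance; [E0] is the
    energy of a frequency present in the limit, and [h] the step rate. *)
Variables (R : realType) (p E q E0 h : nat -> R) (rho : R).
Hypotheses (rho_gt0 : 0 < rho) (h_ge0 : forall t, 0 <= h t).
Hypotheses (h_le1 : forall t, rho * h t <= 1) (q_gt0 : forall t, 0 < q t).
Hypotheses (E_p : forall t, 2 * `|p t| <= E t) (E_q : forall t, q t <= E t).
Hypothesis p_step : forall t, p t + rho * h t * E t <= p t.+1.
Hypothesis q_step : forall t, q t * (1 - rho / 2 * h t) <= q t.+1.
Hypothesis E0_gt0 : forall t, 0 < E0 t.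
Hypothesis E0_step : forall t, E0 t.+1 <= E0 t * (1 + 2 * rho * h t).
Hypothesis E0_unbounded : forall B, exists t, B < E0 t.

Let H t := \sum_(0 <= s < t) h s.

Lemma E0_le_expR t : E0 t <= E0 0 * expR (2 * rho * H t).
Proof.
elim: t => [|t IH]; first by rewrite /H big_geq// mulr0 expR0 mulr1.
apply: le_trans (E0_step t) _; rewrite /H big_nat_recr//= -/(H t) [X in expR X]mulrDr expRD mulrA.
by rewrite ler_pM ?(ltW (E0_gt0 t)) ?expR_ge1Dx ?addr_ge0 ?mulr_ge0 ?(ltW rho_gt0).
Qed.

(** [E0] grows at most exponentially in the accumulated rate, so its unboundedness forces the rates
    to be non-summable. *)
Lemma H_unbounded B : exists t, B < H t.
Proof.
have [t ht] := E0_unbounded (E0 0 * expR (2 * rho * B)).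
exists t; rewrite ltNge; apply/negP => HB; have := E0_le_expR t; apply/negP.
rewrite -ltNge; apply: le_lt_trans ht; rewrite ler_pM2l ?E0_gt0// ler_expR.
by rewrite ler_wpM2l// mulr_ge0// ltW.
Qed.

(* While [p <= 0], the ratio [- p / q] decreases at least by [rho / 2 * h] per step. *)
Lemma p_eventually_pos : exists t, 0 < p t.
Proof.
apply: contrapT => /forallNP np.
have p0 t : p t <= 0 by rewrite leNgt; apply/negP; exact: np.
pose x t := - p 0 / q 0 - rho / 2 * H t.
have inv t : - p t <= q t * x t.
  elim: t => [|t IH].
    by rewrite /x /H big_geq// mulr0 subr0 mulrC divfK// gt_eqF.
  have xS : x t.+1 = x t - rho / 2 * h t.
    by rewrite /x /H big_nat_recr//=; ring.
  have q0 := q_gt0 t; have qS := q_gt0 t.+1; have h0 := h_ge0 t.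
  have := p_step t; have := E_p t; have := E_q t; have := q_step t.
  have := h_le1 t; have := p0 t; have := p0 t.+1.
  rewrite xS ler0_norm// => pS pt hl qs Eq Ep ps.
  have rh : 0 <= rho * h t by rewrite mulr_ge0// ltW.
  (* Averaging [E_q] and [E_p] gives [E t >= q t / 2 - p t] while [p t <= 0]. *)
  have lowE : rho * h t * (q t / 2 - p t) <= rho * h t * E t.
    by rewrite ler_wpM2l//; lra.
  have k1 : (1 - rho * h t) * (- p t) <= (1 - rho * h t) * (q t * x t).
    by rewrite ler_wpM2l//; lra.
  have k2 : - p t.+1 <= q t * (1 - rho / 2 * h t) * (x t - rho / 2 * h t).
    have : 0 <= q t * (rho / 2 * h t) ^+ 2 by rewrite mulr_ge0 ?sqr_ge0// ltW.
    have : 0 <= rho * h t * (q t * x t) by rewrite mulr_ge0//; lra.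
    lra.
  (* A negative factor would make [- p t.+1] negative by [k2]. Nonnegativity then allows
     [q t * (1 - rho / 2 * h t)] to be replaced by the larger [q t.+1]. *)
  have x0 : 0 <= x t - rho / 2 * h t.
    rewrite leNgt; apply/negP => xn.
    have : 0 < q t * (1 - rho / 2 * h t) by rewrite mulr_gt0//; lra.
    move=> c0; have := pmulr_rlt0 (x t - rho / 2 * h t) c0; rewrite xn => /idP; lra.
  by apply: le_trans k2 _; rewrite ler_wpM2r.
have [t ht] := H_unbounded ((- p 0 / q 0) / (rho / 2)).
have : 0 <= q t * x t by apply: le_trans (inv t); rewrite oppr_ge0.
rewrite pmulr_rge0// subr_ge0 leNgt; move: ht; rewrite ltr_pdivrMr ?divr_gt0//.
by rewrite [ltRHS]mulrC => ->.
Qed.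

(** Once [p] is positive, [E >= 2 * p] multiplies it by at least [1 + 2 * rho * h] per step, the
    very factor that bounds the growth of [E0]; the ratio at that time persists. *)
Lemma p_dominates : exists K T, 0 < K /\ forall t, (T <= t)%N -> K * E0 t <= p t.
Proof.
have [T pT] := p_eventually_pos; pose K := p T / E0 T.
have K0 : 0 < K by rewrite divr_gt0.
exists K, T; split=> // t /subnKC <-; elim: (t - T)%N => [|n IH].
  by rewrite addn0 divfK// gt_eqF.
rewrite addnS; set s := (T + n)%N in IH *.
have h0 := h_ge0 s; have e0 := E0_gt0 s.
have ps : 0 <= p s by apply: le_trans IH; rewrite mulr_ge0// ltW.
have := E_p s; rewrite ger0_norm// => Es.
have rh : 0 <= rho * h s by rewrite mulr_ge0// ltW.
apply: (@le_trans _ _ (K * (E0 s * (1 + 2 * rho * h s)))).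
  by rewrite ler_wpM2l ?E0_step// ltW.
apply: le_trans (p_step s).
have k1 : rho * h s * (2 * p s) <= rho * h s * E s by rewrite ler_wpM2l.
have k2 : (1 + 2 * (rho * h s)) * (K * E0 s) <= (1 + 2 * (rho * h s)) * p s.
  by rewrite ler_wpM2l//; lra.
lra.
Qed.

End Growth.

(** * One gradient step at a single frequency of a two-layer network *)

Section Modes.
Variable R : realType.
Implicit Types z c e a b q : R[i].

(** The real inner product of the plane, i.e. the real part of z conj(c). *)
Definition cdot z c : R := let: a1 +i* a2 := z in let: c1 +i* c2 := c in a1 * c1 + a2 * c2.

Lemma cdot_sqr_le z c : cdot z c ^+ 2 <= nsq z * nsq c.
Proof.
case: z c => [a1 a2] [c1 c2]; rewrite /cdot /nsq -subr_ge0.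
rewrite (_ : _ - _ = (a1 * c2 - a2 * c1) ^+ 2) ?sqr_ge0//.
ring.
Qed.

Lemma cdot_le z c (B : R) : 0 <= B -> nsq z * nsq c <= B ^+ 2 -> `|cdot z c| <= B.
Proof.
move=> B0 h; rewrite -ler_sqr ?nnegrE// real_normK ?num_real//.
exact: le_trans (cdot_sqr_le z c) h.
Qed.

Lemma nsqM_le a b : nsq a * nsq b <= ((nsq a + nsq b) / 2) ^+ 2.
Proof.
rewrite -subr_ge0 (_ : _ - _ = ((nsq a - nsq b) / 2) ^+ 2) ?sqr_ge0//.
by field.
Qed.

Variables (h : R) (q a b : R[i]).
Hypothesis h_ge0 : 0 <= h.
Let a' := a + h%:C * q * cj b.
Let b' := b + h%:C * q * cj a.
Let E := nsq a + nsq b.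

Let E_ge0 : 0 <= E. Proof. by rewrite addr_ge0 ?nsq_ge0. Qed.

Lemma mode_cdot_le e : nsq e = 1 -> 2 * `|cdot (a * b) e| <= E.
Proof.
move=> e1; suff : `|cdot (a * b) e| <= E / 2 by lra.
by apply: cdot_le; rewrite ?divr_ge0// e1 mulr1 nsqM nsqM_le.
Qed.

(** The product expands as a' b' = a b + h q E + h^2 q^2 conj(a b), and the last term is controlled
    by |a b| <= E / 2. *)
Lemma mode_product_step e : nsq e = 1 ->
  cdot (a * b) e + h * (cdot q e - h * nsq q / 2) * E <= cdot (a' * b') e.
Proof.
move=> e1.
have -> : cdot (a' * b') e =
    cdot (a * b) e + h * cdot q e * E + h ^+ 2 * cdot (q * q * cj (a * b)) e.
  rewrite /a' /b' /E; move: a b q e {e1} => [a1 a2] [b1 b2] [q1 q2] [e1 e2].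
  by rewrite /cdot /nsq /cj /=; ring.
have : `|cdot (q * q * cj (a * b)) e| <= nsq q * (E / 2).
  apply: cdot_le; first by rewrite mulr_ge0 ?nsq_ge0 ?divr_ge0.
  rewrite e1 mulr1 !nsqM nsq_conj nsqM -expr2 exprMn ler_wpM2l ?sqr_ge0//.
  exact: nsqM_le.
rewrite ler_norml => /andP[l1 _].
have := ler_wpM2l (sqr_ge0 h) l1; lra.
Qed.

Lemma mode_difference_step : nsq a' - nsq b' = (nsq a - nsq b) * (1 - h ^+ 2 * nsq q).
Proof.
rewrite /a' /b'; move: a b q => [a1 a2] [b1 b2] [q1 q2].
by rewrite /nsq /cj /=; ring.
Qed.

Lemma mode_energy_step (s : R) : 0 <= s -> nsq q = s ^+ 2 ->
  nsq a' + nsq b' <= E * (1 + h * (2 * s + h * s ^+ 2)).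
Proof.
move=> s0 qs.
have -> : nsq a' + nsq b' = E * (1 + h ^+ 2 * nsq q) + 4 * h * cdot q (a * b).
  rewrite /a' /b' /E; move: a b q {qs} => [a1 a2] [b1 b2] [q1 q2].
  by rewrite /cdot /nsq /cj /=; ring.
have : `|cdot q (a * b)| <= s * (E / 2).
  apply: cdot_le; first by rewrite mulr_ge0 ?divr_ge0.
  by rewrite nsqM qs exprMn ler_wpM2l ?sqr_ge0// nsqM_le.
rewrite ler_norml qs => /andP[_ l1].
have := ler_wpM2l h_ge0 l1; lra.
Qed.

End Modes.

(** * The limit direction *)

Lemma le_sum_term (R : realType) (I : finType) (f : I -> R) :
  (forall i, 0 <= f i) -> forall i, f i <= \sum_j f j.
Proof. by move=> f0 i; rewrite (bigD1 i)//= lerDl sumr_ge0. Qed.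

Section Norms.
Variables (R : realType) (D' L : nat).
Notation D := D'.+1.
Implicit Types (u : 'I_L -> 'I_D -> R) (w : 'I_D -> R).

Lemma pnorm_ge0 u : 0 <= pnorm u.
Proof. exact: sqrtr_ge0. Qed.

Lemma enorm_ge0 w : 0 <= enorm w.
Proof. exact: sqrtr_ge0. Qed.

Lemma sqr_pnorm u : pnorm u ^+ 2 = \sum_i \sum_d u i d ^+ 2.
Proof.
rewrite sqr_sqrtr//; apply: sumr_ge0 => i _; apply: sumr_ge0 => d _.
exact: sqr_ge0.
Qed.

Lemma sqr_enorm w : enorm w ^+ 2 = \sum_d w d ^+ 2.
Proof. by rewrite sqr_sqrtr// sumr_ge0// => d _; exact: sqr_ge0. Qed.

Lemma pnorm_eq0 u i d : pnorm u = 0 -> u i d = 0.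
Proof.
move=> /(congr1 (fun x => x ^+ 2)); rewrite sqr_pnorm expr0n/= => /eqP.
rewrite psumr_eq0 => [/allP/(_ i (mem_index_enum i))/=|j _]; last first.
  by apply: sumr_ge0 => k _; exact: sqr_ge0.
rewrite psumr_eq0 => [/allP/(_ d (mem_index_enum d))/=|j _]; last exact: sqr_ge0.
by rewrite sqrf_eq0 => /eqP.
Qed.

Lemma enorm_eq0 w d : enorm w = 0 -> w d = 0.
Proof.
move=> /(congr1 (fun x => x ^+ 2)); rewrite sqr_enorm expr0n/= => /eqP.
rewrite psumr_eq0 => [/allP/(_ d (mem_index_enum d))/=|j _]; last exact: sqr_ge0.
by rewrite sqrf_eq0 => /eqP.
Qed.

Lemma enormZ (c : R) w : 0 <= c -> enorm (fun d => c * w d) = c * enorm w.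
Proof.
move=> c0; rewrite /enorm; under eq_bigr do rewrite exprMn.
by rewrite -mulr_sumr sqrtrM ?sqr_ge0// sqrtr_sqr ger0_norm.
Qed.

Lemma enormN w : enorm (fun d => - w d) = enorm w.
Proof. by rewrite /enorm; under eq_bigr do rewrite sqrrN. Qed.

Lemma pnorm_le_sum u : pnorm u <= \sum_i \sum_d `|u i d|.
Proof.
have S0 : 0 <= \sum_i \sum_d `|u i d| by apply: sumr_ge0 => i _; apply: sumr_ge0.
rewrite -ler_sqr ?nnegrE ?pnorm_ge0// sqr_pnorm expr2 mulr_suml.
apply: ler_sum => i _; rewrite mulr_suml; apply: ler_sum => d _.
rewrite -real_normK ?num_real// expr2 ler_wpM2l//.
rewrite (bigD1 i)//= (bigD1 d)//= -addrA lerDl addr_ge0// sumr_ge0// => j _.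
exact: sumr_ge0.
Qed.

End Norms.

Section Dynamics.
Variables (R : realType) (D' L N : nat).
Notation D := D'.+1.
Variables (X : 'I_N -> 'I_D -> R) (y : 'I_N -> R).
Variables (u : nat -> 'I_L -> 'I_D -> R) (eta : nat -> R).
Hypotheses (L_gt1 : (1 < L)%N) (N_gt0 : (0 < N)%N).
Hypothesis step : forall t, step_ok (lossu X y) (u t) (eta t).
Hypothesis gd : forall t l d,
  u t.+1 l d = u t l d - eta t * gradu (lossu X y) (u t) l d.
Hypothesis loss0 : lossu X y (u t) @[t --> \oo] --> (0 : R).
Variable ubar : 'I_L -> 'I_D -> R.
Hypothesis u_dir : forall i j, u t i j / pnorm (u t) @[t --> \oo] --> ubar i j.

Let L_gt0 : (0 < L)%N := ltnW L_gt1.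

Definition nrm t : R := pnorm (u t).
Definition dir t : 'I_L -> 'I_D -> R := fun i j => u t i j / nrm t.
Definition mu n : R := y n * fconv ubar (X n).
Definition mudir t n : R := y n * fconv (dir t) (X n).

Lemma nrm_ge0 t : 0 <= nrm t. Proof. exact: pnorm_ge0. Qed.

(* Also valid when [nrm t = 0], since then [u t = 0]. *)
Lemma uE t : u t = fun i j => nrm t * dir t i j.
Proof.
apply/funext => i; apply/funext => j; rewrite /dir mulrC.
have [n0|n0] := eqVneq (nrm t) 0; last by rewrite divfK.
by rewrite n0 mulr0 pnorm_eq0.
Qed.

Lemma marginE t n : margin X y (u t) n = nrm t ^+ L * mudir t n.
Proof. by rewrite /margin uE fconvZ// mulrCA. Qed.

Lemma cvg_mudir n : mudir t n @[t --> \oo] --> mu n.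
Proof. by apply: cvgMl_tmp; exact: cvg_fconv. Qed.

(** On a bounded set of weights with [mudir] near its limit, the margin of one sample stays bounded,
    which keeps the loss away from 0. *)
Lemma nrm_gt B : \forall t \near \oo, B < nrm t.
Proof.
pose n0 := Ordinal N_gt0; pose K := `|mu n0| + 1.
have K0 : 0 < K by rewrite ltr_wpDl.
have muK : mu n0 < K by rewrite /K (le_lt_trans (ler_norm _))// ltrDl.
have h1 : \forall t \near \oo, mudir t n0 < K.
  exact: (cvgr_lt _ (@cvg_mudir n0) _ muK).
have h2 : \forall t \near \oo, lossu X y (u t) < expR (- (`|B| ^+ L * K)).
  exact: (cvgr_lt _ loss0 _ (expR_gt0 _)).
near=> t; rewrite ltNge; apply/negP => nB.
have q1 : mudir t n0 < K by near: t.
have : lossu X y (u t) < expR (- (`|B| ^+ L * K)) by near: t.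
apply/negP; rewrite -leNgt lossuE// (bigD1 n0)//=.
apply: ler_wpDr; first by apply: sumr_ge0 => i _; exact: expR_ge0.
rewrite ler_expR lerN2 marginE.
apply: (@le_trans _ _ (nrm t ^+ L * K)).
  by rewrite ler_wpM2l ?exprn_ge0 ?nrm_ge0// ltW.
rewrite ler_wpM2r// ?(ltW K0)// lerXn2r ?nnegrE ?nrm_ge0//.
exact: le_trans nB (ler_norm _).
Unshelve. all: by end_near. Qed.

Lemma ubar_norm : \sum_i \sum_d ubar i d ^+ 2 = 1.
Proof.
apply: (@cvgr_eq_lim R nat \oo _ (fun t => \sum_i \sum_d dir t i d ^+ 2) (cst 1)).
- by apply: cvg_sumr => i; apply: cvg_sumr => d; apply: cvg_sqr; exact: u_dir.
- exact: cvg_cst.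
near=> t; rewrite /=; have n0 : 0 < nrm t by near: t; exact: nrm_gt.
under eq_bigr => i _ do under eq_bigr => d _ do rewrite expr_div_n.
under eq_bigr => i _ do rewrite -mulr_suml.
by rewrite -mulr_suml -sqr_pnorm divff// expf_neq0// gt_eqF.
Unshelve. all: by end_near. Qed.

Lemma nsq_dftc_u t i d :
  nsq (dftc (u t i) d) = nrm t ^+ 2 * nsq (dftc (dir t i) d).
Proof. by rewrite [in LHS]uE dftcZ nsqM nsq_real. Qed.

Lemma balance_bounded t i k d : i != k ->
  `|nsq (dftc (u t i) d) - nsq (dftc (u t k) d)| <=
  `|nsq (dftc (u 0 i) d) - nsq (dftc (u 0 k) d)|.
Proof.
move=> ik; elim: t => [//|t IH]; apply: le_trans IH.
exact: (gd_balance_le L_gt0 ik (step t) (gd t)).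
Qed.

(** The imbalance of [u t] never exceeds its initial value, while passing to [dir t] divides it by
    [nrm t ^+ 2], which diverges. *)
Lemma balanced i k d : nsq (dftc (ubar i) d) = nsq (dftc (ubar k) d).
Proof.
have [->//|ik] := eqVneq i k.
pose C := `|nsq (dftc (u 0 i) d) - nsq (dftc (u 0 k) d)|.
pose diff t := nsq (dftc (dir t i) d) - nsq (dftc (dir t k) d).
have h : diff t @[t --> \oo] --> nsq (dftc (ubar i) d) - nsq (dftc (ubar k) d).
  by apply: cvgB; apply: cvg_nsq_dftc => j; exact: u_dir.
apply/eqP; rewrite -subr_eq0; apply/eqP.
suff h0 : diff t @[t --> \oo] --> (0 : R) by exact: (norm_cvg_unique h h0).
apply/cvgrPdist_le => e e0; near=> t; rewrite sub0r normrN.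
have n1 : 1 < nrm t by near: t; exact: nrm_gt.
have nC : C / e < nrm t by near: t; exact: nrm_gt.
have n0 : 0 < nrm t by rewrite (lt_trans ltr01).
have := balance_bounded t d ik; rewrite -/C !nsq_dftc_u -mulrBr normrM ger0_norm ?sqr_ge0//.
rewrite [leLHS]mulrC -ler_pdivlMr ?exprn_gt0//.
move/le_trans; apply; rewrite ler_pdivrMr ?exprn_gt0//.
move: nC; rewrite ltr_pdivrMr// mulrC => /ltW/le_trans; apply.
by rewrite ler_pM2l// expr2 ler_peMr// ltW.
Unshelve. all: by end_near. Qed.

Let i0 : 'I_L := Ordinal L_gt0.

Definition modulus2 d : R := nsq (dftc (ubar i0) d).

Lemma nsq_dftc_Pubar d : nsq (dftc (Pconv ubar) d) = modulus2 d ^+ L.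
Proof.
rewrite dftc_Pconv// nsq_prod (eq_bigr (fun=> modulus2 d)).
  by rewrite prodr_const card_ord.
by move=> i _; exact: balanced.
Qed.

Lemma exists_frequency : exists d, modulus2 d != 0.
Proof.
apply: contrapT => /forallNP H.
have: \sum_i \sum_d ubar i d ^+ 2 = 0.
  apply: big1 => i _; rewrite -parseval; apply: big1 => d _.
  by rewrite (balanced i i0); apply/eqP; move/negP: (H d); rewrite negbK.
by rewrite ubar_norm => /eqP; rewrite oner_eq0.
Qed.

Definition kappa : R := enorm (Pconv ubar).

(** At a frequency where one layer of [ubar] is nonzero all of them are, by balance, hence so is
    their product. *)
Lemma kappa_gt0 : 0 < kappa.
Proof.
rewrite lt_def enorm_ge0 andbT; apply/eqP => k0.
have [d] := exists_frequency; have := parseval (Pconv ubar).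
rewrite -sqr_enorm [enorm _]k0 expr0n /= => /eqP; rewrite psumr_eq0 => [|j _]; last exact: nsq_ge0.
move=> /allP/(_ d (mem_index_enum d)) /=.
by rewrite nsq_dftc_Pubar expf_eq0 L_gt0 /= => ->.
Qed.

Lemma w_dir t d : nrm t != 0 ->
  Pconv (u t) d / enorm (Pconv (u t)) = Pconv (dir t) d / enorm (Pconv (dir t)).
Proof.
move=> n0.
have -> : Pconv (u t) = fun d => nrm t ^+ L * Pconv (dir t) d.
  by apply/funext => j; rewrite [in LHS]uE; exact: fconvZ.
rewrite enormZ ?exprn_ge0 ?nrm_ge0// -mulf_div divff ?mul1r//.
by rewrite expf_neq0.
Qed.

Variable wbar : 'I_D -> R.
Hypothesis w_lim :
  cvg_to_vec (fun t d => Pconv (u t) d / enorm (Pconv (u t))) wbar.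
Hypothesis wbar_margin : forall n, 0 < y n * dotp (X n) wbar.

Lemma Pubar_wbar d : Pconv ubar d = kappa * wbar d.
Proof.
have k0 := kappa_gt0; apply: (mulfI (invr_neq0 (lt0r_neq0 k0))).
rewrite mulKf ?gt_eqF// mulrC.
have cP j : Pconv (dir t) j @[t --> \oo] --> Pconv ubar j by exact: cvg_fconv.
have cE : enorm (Pconv (dir t)) @[t --> \oo] --> kappa.
  by apply: cvg_sqrt; apply: cvg_sumr => j; exact: cvg_sqr.
have c1 : Pconv (dir t) d / enorm (Pconv (dir t)) @[t --> \oo] --> Pconv ubar d / kappa.
  by apply: cvgM => //; apply: cvgV => //; rewrite gt_eqF.
have wl := @w_lim d; apply: (cvgr_eq_lim c1 wl); near=> t.
by rewrite w_dir// gt_eqF//; near: t; exact: nrm_gt.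
Unshelve. all: by end_near. Qed.

Lemma muE n : mu n = kappa * (y n * dotp (X n) wbar).
Proof.
rewrite /mu -dotp_Pconv// (_ : Pconv ubar = fun d => kappa * wbar d).
  by rewrite dotpZr mulrCA.
by apply/funext => d; rewrite Pubar_wbar.
Qed.

Lemma mu_gt0 n : 0 < mu n.
Proof. by rewrite muE mulr_gt0 ?kappa_gt0. Qed.

Variable zl : 'I_D -> R.
Hypothesis z_lim : forall d, gradw (lossw X y) (Pconv (u t)) d /
  enorm (gradw (lossw X y) (Pconv (u t))) @[t --> \oo] --> zl d.

Definition res t : 'I_D -> R := residual X y (u t).
Definition zbar d : R := - zl d.
Definition resdir t d : R := res t d / enorm (res t).
Definition weight t n : R := expR (- margin X y (u t) n) / enorm (res t).

Lemma cvg_resdir d : resdir t d @[t --> \oo] --> zbar d.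
Proof.
have : - (gradw (lossw X y) (Pconv (u t)) d /
  enorm (gradw (lossw X y) (Pconv (u t)))) @[t --> \oo] --> zbar d by exact: cvgN.
rewrite (_ : (fun t => _) = resdir ^~ d)//; apply/funext => t.
have -> : gradw (lossw X y) (Pconv (u t)) = fun d => - res t d.
  by apply/funext => j; exact: gradwE.
by rewrite enormN mulNr opprK.
Qed.

(** [Pconv ubar] separates the data, so every sample contributes positively to its inner product
    with the residual. *)
Lemma res_norm_gt0 t : 0 < enorm (res t).
Proof.
rewrite lt_def enorm_ge0 andbT; apply/eqP => z0.
have : 0 < dotp (res t) (Pconv ubar).
  rewrite (dotp_suml _ (fun n d => _ * X n d)) (bigD1 (Ordinal N_gt0))//=.
  have P n : 0 < dotp (fun d => expR (- margin X y (u t) n) * y n * X n d) (Pconv ubar).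
    by rewrite dotpZl dotp_Pconv// -mulrA mulr_gt0 ?expR_gt0 ?mu_gt0.
  by apply: ltr_wpDr => //; apply: sumr_ge0 => n _; exact: ltW.
by rewrite /dotp big1 ?ltxx// => d _; rewrite enorm_eq0// mul0r.
Qed.

Lemma zbar_norm : \sum_d zbar d ^+ 2 = 1.
Proof.
apply: (@cvgr_eq_lim R nat \oo _ (fun t => \sum_d resdir t d ^+ 2) (cst 1)).
- by apply: cvg_sumr => d; apply: cvg_sqr; exact: cvg_resdir.
- exact: cvg_cst.
apply: nearW => t /=; under eq_bigr do rewrite expr_div_n.
by rewrite -mulr_suml -sqr_enorm divff// expf_neq0// gt_eqF// res_norm_gt0.
Qed.

Lemma resdirE t d : resdir t d = \sum_(n < N) weight t n * y n * X n d.
Proof.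
rewrite /resdir /res /residual mulr_suml; apply: eq_bigr => n _.
by rewrite /weight; ring.
Qed.

Lemma weight_ge0 t n : 0 <= weight t n.
Proof. by rewrite divr_ge0 ?expR_ge0 ?enorm_ge0. Qed.

Lemma resdir_le1 t d : `|resdir t d| <= 1.
Proof.
rewrite -ler_sqr ?nnegrE// real_normK ?num_real// expr_div_n expr1n.
rewrite ler_pdivrMr ?exprn_gt0 ?res_norm_gt0// mul1r sqr_enorm (bigD1 d)//= lerDl.
by apply: sumr_ge0 => j _; exact: sqr_ge0.
Qed.

(** Pairing the unit vector [resdir t] with [Pconv ubar] gives the sum of the nonnegative terms
    [weight t n * mu n], bounded independently of [t]. *)
Lemma weight_bounded : exists2 K : R, 0 < K & forall t n, weight t n <= K.
Proof.
pose K0 := \sum_d `|Pconv ubar d|.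
pose K := \sum_(n < N) (K0 / mu n) + 1.
have q0 n : 0 <= K0 / mu n by rewrite divr_ge0 ?sumr_ge0// ltW// mu_gt0.
exists K; first by rewrite ltr_wpDl ?sumr_ge0.
move=> t n; apply: (@le_trans _ _ (K0 / mu n)); last first.
  rewrite /K (bigD1 n)//= -addrA lerDl addr_ge0// sumr_ge0//.
rewrite ler_pdivlMr ?mu_gt0//.
apply: (@le_trans _ _ (dotp (resdir t) (Pconv ubar))); last first.
  apply: ler_sum => d _; apply: le_trans (ler_norm _) _.
  by rewrite normrM ler_piMl// resdir_le1.
rewrite (_ : resdir t = fun d => \sum_(n < N) weight t n * y n * X n d); last first.
  by apply/funext => d; exact: resdirE.
rewrite (dotp_suml _ (fun n d => _ * X n d)) (bigD1 n)//= dotpZl dotp_Pconv// -mulrA.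
rewrite lerDl; apply: sumr_ge0 => k _.
by rewrite dotpZl dotp_Pconv// -mulrA mulr_ge0 ?weight_ge0// ltW// mu_gt0.
Qed.

(** The ratio of the weights of [n] and [k] is the exponential of minus the margin gap, which grows
    at least linearly in [nrm t]. *)
Lemma weight_cvg0 n k : mu k < mu n -> weight t n @[t --> \oo] --> (0 : R).
Proof.
move=> kn; have [K K0 hK] := weight_bounded.
have [c c0 cmu] : exists2 c, 0 < c & c < mu n - mu k.
  by exists ((mu n - mu k) / 2); lra.
have h1 : \forall t \near \oo, c < mudir t n - mudir t k.
  have cd : mudir t n - mudir t k @[t --> \oo] --> mu n - mu k.
    by apply: cvgB; exact: cvg_mudir.
  exact: (cvgr_gt _ cd).
apply/cvgrPdist_le => e e0.
near=> t; rewrite sub0r normrN ger0_norm ?weight_ge0//.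
have d1 : c < mudir t n - mudir t k by near: t.
have n1 : 1 < nrm t by near: t; exact: nrm_gt.
have n2 : K / (c * e) < nrm t by near: t; exact: nrm_gt.
have n0 : 0 < nrm t by rewrite (lt_trans ltr01).
have -> : weight t n = weight t k * expR (- (nrm t ^+ L * (mudir t n - mudir t k))).
  rewrite /weight mulrAC -expRD; congr (expR _ / _).
  by rewrite !marginE; ring.
have nc : nrm t * c <= nrm t ^+ L * (mudir t n - mudir t k).
  rewrite ler_pM ?(ltW n0) ?(ltW c0) ?(ltW d1)//.
  by rewrite -[leLHS]expr1 ler_weXn2l ?(ltW n1).
have E : expR (- (nrm t ^+ L * (mudir t n - mudir t k))) <= (nrm t * c)^-1.
  rewrite expRN lef_pV2 ?posrE ?expR_gt0 ?mulr_gt0//.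
  apply: le_trans (expR_ge1Dx _); apply: le_trans nc _; lra.
apply: (@le_trans _ _ (K * (nrm t * c)^-1)).
  by rewrite ler_pM ?weight_ge0 ?expR_ge0.
rewrite ler_pdivrMr ?mulr_gt0//; move: n2; rewrite ltr_pdivrMr ?mulr_gt0//.
by move=> ?; lra.
Unshelve. all: by end_near. Qed.

(** The weights may oscillate, but being bounded they converge along an ultrafilter finer than
    [\oo], along which the limits already known are unchanged. *)
Lemma exists_multipliers : exists alpha : 'I_N -> R,
  [/\ forall n, 0 <= alpha n, forall n k, mu k < mu n -> alpha n = 0 &
      forall d, zbar d = \sum_(n < N) alpha n * y n * X n d].
Proof.
have [U [FU sU]] := @ultraFilterLemma nat \oo _.
have FP : ProperFilter U by exact: ultra_proper.
have [K K0 hK] := weight_bounded.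
have ooU (f : nat -> R) (l : R) : f t @[t --> \oo] --> l -> f t @[t --> U] --> l.
  by move=> h B Bl; apply: sU; exact: h.
have /choice[alpha ha] n : exists l : R, weight t n @[t --> U] --> l.
  by apply: (bounded_cvg_ultra (a := 0) (b := K)); apply: nearW => t; rewrite weight_ge0 hK.
exists alpha; split.
- move=> n; rewrite leNgt; apply/negP => an.
  have : \forall t \near U, weight t n < 0 by exact: (cvgr_lt _ (ha n) _ an).
  by move=> /filter_ex[t]; rewrite ltNge weight_ge0.
- by move=> n k /weight_cvg0 /ooU h; exact: (norm_cvg_unique (ha n) h).
- move=> d.
  suff h : resdir t d @[t --> U] --> \sum_(n < N) alpha n * y n * X n d.
    exact: (norm_cvg_unique (ooU _ _ (@cvg_resdir d)) h).
  under eq_fun do rewrite resdirE.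
  by apply: cvg_sumr => n; do 2 apply: cvgMr_tmp; exact: ha.
Qed.

(** The value is the sum of [alpha n * mu n]; were it 0, all multipliers and then [zbar] would
    vanish, against its unit norm. *)
Lemma dotp_zbar_gt0 : 0 < fconv ubar zbar.
Proof.
have [alpha [a0 _ aE]] := exists_multipliers.
have zE : zbar = fun d => \sum_(n < N) (alpha n * y n) * X n d.
  by apply/funext => d; rewrite aE.
have fE : fconv ubar zbar = \sum_(n < N) alpha n * mu n.
  by rewrite [in LHS]zE fconv_suml//; apply: eq_bigr => n _; rewrite mulrA.
have p0 n : 0 <= alpha n * mu n by rewrite mulr_ge0// ltW// mu_gt0.
rewrite lt_def fE sumr_ge0// andbT; apply/eqP => /eqP.
rewrite psumr_eq0// => /allP h; have := zbar_norm; rewrite big1 => [/eqP|d _].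
  by rewrite eq_sym oner_eq0.
rewrite aE big1 ?expr0n// => n _; have := h n (mem_index_enum n).
by rewrite mulf_eq0 (gt_eqF (mu_gt0 n)) orbF => /eqP ->; rewrite !mul0r.
Qed.

Lemma eta_gt0 t : 0 < eta t.
Proof. by case: (step t). Qed.

(** Homogeneity factors each gradient step into the scalar [cstep] and the convergent vector
    [gstep]. *)
Definition cstep t := eta t * nrm t ^+ L.-1 * enorm (res t).
Definition gstep t i d := cfold (dir t) (others i) (resdir t) d.
Definition Gbar i d := cfold ubar (others i) zbar d.

Lemma cstep_ge0 t : 0 <= cstep t.
Proof.
by rewrite /cstep !mulr_ge0 ?exprn_ge0 ?nrm_ge0 ?enorm_ge0// ltW// eta_gt0.
Qed.

Lemma u_step t i d : u t.+1 i d = u t i d + cstep t * gstep t i d.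
Proof.
rewrite gd graduE// mulrN opprK; congr (_ + _).
have -> : residual X y (u t) = fun d => enorm (res t) * resdir t d.
  apply/funext => j; rewrite /resdir mulrC divfK// gt_eqF//.
  exact: res_norm_gt0.
by rewrite [in LHS]uE cfoldZ size_others /cstep /gstep !mulrA.
Qed.

Lemma u_sum n i d : u n i d = u 0 i d + \sum_(0 <= t < n) cstep t * gstep t i d.
Proof.
elim: n => [|n IH]; first by rewrite big_geq// addr0.
by rewrite u_step IH big_nat_recr//= addrA.
Qed.

Lemma cvg_gstep i d : gstep t i d @[t --> \oo] --> Gbar i d.
Proof. by apply: cvg_cfold => [j k|j]; [exact: u_dir|exact: cvg_resdir]. Qed.

(** [gstep] is bounded, so [nrm n] is at most affine in the accumulated [cstep]; since the norm
    diverges, so does the sum. *)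
Lemma cstep_sum_cvgy : \sum_(0 <= t < n) cstep t @[n --> \oo] --> +oo.
Proof.
have /choice[K hK] (ij : 'I_L * 'I_D) :
    exists K, forall t, `|gstep t ij.1 ij.2| <= K.
  have : cvgn (fun t => gstep t ij.1 ij.2).
    by apply/cvg_ex; exists (Gbar ij.1 ij.2); exact: cvg_gstep.
  by move=> /cvg_seq_bounded/pinfty_ex_gt0[K _ h]; exists K => t; exact: h.
pose A := \sum_i \sum_d `|u 0 i d|; pose KK := \sum_i \sum_d K (i, d).
have KK0 : 0 <= KK.
  apply: sumr_ge0 => i _; apply: sumr_ge0 => d _.
  exact: le_trans (normr_ge0 _) (hK (i, d) 0).
have bound n : nrm n <= A + KK * \sum_(0 <= t < n) cstep t.
  apply: le_trans (pnorm_le_sum _) _; rewrite /A /KK mulr_suml -big_split /=.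
  apply: ler_sum => i _; rewrite mulr_suml -big_split /=; apply: ler_sum => d _.
  rewrite u_sum; apply: le_trans (ler_normD _ _) _; rewrite lerD2l.
  apply: le_trans (ler_norm_sum _ _ _) _; rewrite mulr_sumr; apply: ler_sum => t _.
  by rewrite normrM ger0_norm ?cstep_ge0// mulrC ler_wpM2r ?cstep_ge0// (hK (i, d)).
apply/cvgryPgt => B; near=> n; rewrite ltNge; apply/negP => CB.
have : A + KK * `|B| < nrm n by near: n; exact: nrm_gt.
apply/negP; rewrite -leNgt; apply: le_trans (bound n) _; rewrite lerD2l ler_wpM2l//.
exact: le_trans CB (ler_norm _).
Unshelve. all: by end_near. Qed.

Lemma cvg_u_cstep i d :
  u n i d / \sum_(0 <= t < n) cstep t @[n --> \oo] --> Gbar i d.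
Proof.
have -> : (fun n => u n i d / \sum_(0 <= t < n) cstep t) =
    (fun n => u 0 i d * (\sum_(0 <= t < n) cstep t)^-1 +
       (\sum_(0 <= t < n) cstep t * gstep t i d) / \sum_(0 <= t < n) cstep t).
  by apply/funext => n; rewrite u_sum mulrDl.
have -> : Gbar i d = u 0 i d * 0 + Gbar i d by rewrite mulr0 add0r.
apply: cvgD.
  apply: cvgMl_tmp; have Cpos : \forall n \near \oo, 0 < \sum_(0 <= t < n) cstep t.
    by have /cvgryPgt := cstep_sum_cvgy; exact.
  exact: (proj2 (gtr0_cvgV0 Cpos) cstep_sum_cvgy).
exact: weighted_cesaro cstep_ge0 cstep_sum_cvgy (@cvg_gstep i d).
Qed.

(** The same iterates converge to [ubar] after division by their norm and to [Gbar] after division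
    by the accumulated [cstep], so [lam] is the inverse norm of [Gbar]. That norm is nonzero because
    [Gbar i0] has positive inner product with [ubar i0]. *)
Lemma exists_stationary : exists2 lam : R, 0 < lam &
  forall i d, ubar i d = lam * Gbar i d.
Proof.
pose S := \sum_i \sum_d Gbar i d ^+ 2.
have S0 : 0 < S.
  rewrite lt_def; apply/andP; split; last first.
    by apply: sumr_ge0 => i _; apply: sumr_ge0 => d _; exact: sqr_ge0.
  apply/eqP => S0; have := dotp_zbar_gt0; rewrite (fconvE i0) /dotp big1 ?ltxx// => d _.
  have : pnorm Gbar = 0 by rewrite /pnorm -/S S0 sqrtr0.
  by move=> /(pnorm_eq0 i0 d); rewrite /Gbar => ->; rewrite mul0r.
have C0 : \forall n \near \oo, 0 < \sum_(0 <= t < n) cstep t.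
  by have /cvgryPgt := cstep_sum_cvgy; exact.
have cn : nrm n / \sum_(0 <= t < n) cstep t @[n --> \oo] --> Num.sqrt S.
  have : Num.sqrt (\sum_i \sum_d (u n i d / \sum_(0 <= t < n) cstep t) ^+ 2)
      @[n --> \oo] --> Num.sqrt S.
    apply: cvg_sqrt; apply: cvg_sumr => i; apply: cvg_sumr => d; apply: cvg_sqr.
    exact: cvg_u_cstep.
  apply: cvg_trans; apply: near_eq_cvg; apply: filterS C0 => n C0.
  under eq_bigr => i _ do under eq_bigr => d _ do rewrite expr_div_n.
  under eq_bigr => i _ do rewrite -mulr_suml.
  rewrite -mulr_suml -sqr_pnorm -expr_div_n sqrtr_sqr ger0_norm//.
  by rewrite divr_ge0 ?nrm_ge0// ltW.
have sS : 0 < Num.sqrt S by rewrite sqrtr_gt0.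
exists (Num.sqrt S)^-1; first by rewrite invr_gt0.
move=> i d; rewrite mulrC.
have c1 : (u n i d / \sum_(0 <= t < n) cstep t) /
    (nrm n / \sum_(0 <= t < n) cstep t) @[n --> \oo] --> Gbar i d / Num.sqrt S.
  apply: cvgM; first exact: cvg_u_cstep.
  by apply: cvgV => //; rewrite gt_eqF.
apply: (cvgr_eq_lim (@u_dir i d) c1); apply: filterS C0 => n C0.
by rewrite invf_div mulrA divfK// gt_eqF.
Qed.

(** Stationarity is substituted in the layer [i0] only; each remaining layer then meets its own
    conjugate and yields [modulus2 d]. *)
Lemma dftc_stationary lam d : (forall i d, ubar i d = lam * Gbar i d) ->
  dftc (Pconv ubar) d = (lam * modulus2 d ^+ L.-1)%:C * dftc zbar d.
Proof.
move=> h; rewrite dftc_Pconv// (bigD1 i0)//= -big_others.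
have -> : ubar i0 = fun d => lam * Gbar i0 d by apply/funext => j; exact: h.
rewrite dftcZ dftc_cfold.
set P1 := \prod_(i <- _) cj _; set P2 := \prod_(i <- _) _.
have E : P1 * P2 = (modulus2 d ^+ L.-1)%:C.
  rewrite /P1 /P2 -big_split /= (eq_bigr (fun=> (modulus2 d)%:C)).
    by rewrite big_const_seq count_predT size_others iter_mulr_1 -rmorphXn.
  by move=> i _; rewrite mulrC mul_conj (balanced i i0).
transitivity (lam%:C * dftc zbar d * (P1 * P2)); first by ring.
by rewrite E real_complexM; ring.
Qed.

(** * Step rates, and the vanishing frequencies of two-layer networks *)

Lemma res_le_loss : exists2 K : R, 0 < K &
  forall t, enorm (res t) <= K * lossu X y (u t).
Proof.
pose c n := \sum_d `|y n * X n d|.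
have c0 n : 0 <= c n by exact: sumr_ge0.
have cle n : c n <= \sum_n c n + 1.
  by rewrite (le_trans (le_sum_term c0 n))// lerDl.
exists (\sum_n c n + 1); first by rewrite ltr_wpDl// sumr_ge0.
move=> t; apply: (@le_trans _ _ (\sum_d `|res t d|)).
  rewrite -ler_sqr ?nnegrE ?enorm_ge0 ?sumr_ge0// sqr_enorm expr2 mulr_suml.
  apply: ler_sum => d _; rewrite -real_normK ?num_real// expr2 ler_wpM2l//.
  by rewrite (bigD1 d)//= lerDl sumr_ge0.
apply: (@le_trans _ _ (\sum_d \sum_n expR (- margin X y (u t) n) * `|y n * X n d|)).
  apply: ler_sum => d _; apply: le_trans (ler_norm_sum _ _ _) _.
  by apply: ler_sum => n _; rewrite -mulrA normrM ger0_norm ?expR_ge0.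
rewrite exchange_big lossuE// mulr_sumr /=; apply: ler_sum => n _.
by rewrite -mulr_sumr mulrC ler_wpM2r ?expR_ge0// cle.
Qed.

Definition rate t := eta t * enorm (res t).

Lemma rate_ge0 t : 0 <= rate t.
Proof. by rewrite mulr_ge0 ?enorm_ge0// ltW// eta_gt0. Qed.

(* The curvature bound in the direction of [u t] itself. *)
Lemma step_margin t : eta t * \sum_(n < N) expR (- margin X y (u t) n) *
  (4 * margin X y (u t) n ^+ 2 - 2 * margin X y (u t) n) <= nrm t ^+ 2.
Proof.
pose k : 'I_L := Ordinal L_gt1.
have ik : i0 != k by [].
have := step_curvature L_gt0 (u t i0) (u t k) ik (step t).
(* Moving the two layers along themselves gives first and second coefficients [2 * margin] and
   [margin]. *)
rewrite (eq_bigr (fun n => expR (- margin X y (u t) n) *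
  (4 * margin X y (u t) n ^+ 2 - 2 * margin X y (u t) n))) => [h|n _]; last first.
  rewrite (pairingC _ _ _ _ _ (u t i0) (u t k)).
  have -> : pairing (u t) i0 k (X n) (u t k) (u t i0) = fconv (u t) (X n).
    by rewrite (fconvE2 _ _ ik).
  by rewrite /margin; congr (_ * _); ring.
apply: le_trans h _; rewrite sqr_pnorm (bigD1 i0)//= (bigD1 k)//= addrA lerDl.
apply: sumr_ge0 => i _; apply: sumr_ge0 => d _.
exact: sqr_ge0.
Qed.

(** Eventually each margin m is at least [c * nrm t ^+ 2] and at least 1, so 4 m^2 - 2 m >= 2 m^2.
    The curvature bound then makes [eta t] times the loss of order [nrm t ^- 2], and the loss
    dominates the residual. *)
Lemma rate_cvg0 : rate t @[t --> \oo] --> (0 : R).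
Proof.
have [K K0 hK] := res_le_loss.
have [c c0 hc] : exists2 c, 0 < c & forall n, c < mu n.
  have [k _ kmin] := @Order.TotalTheory.arg_minP _ _ 'I_N (Ordinal N_gt0) xpredT mu isT.
  exists (mu k / 2); first by rewrite divr_gt0// mu_gt0.
  by move=> n; have := kmin n isT; have := mu_gt0 k; lra.
have hn : \forall t \near \oo, forall n, c < mudir t n.
  by apply: filter_forall => n; exact: (cvgr_gt _ (@cvg_mudir n) _ (hc n)).
apply/cvgrPdist_le => e e0; near=> t; rewrite sub0r normrN ger0_norm ?rate_ge0//.
have n1 : 1 < nrm t by near: t; exact: nrm_gt.
have n2 : c^-1 < nrm t by near: t; exact: nrm_gt.
have n3 : K / (2 * c ^+ 2 * e) < nrm t by near: t; exact: nrm_gt.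
have mc : forall n, c < mudir t n by near: t.
have n0 : 0 < nrm t by rewrite (lt_trans ltr01).
have et := eta_gt0 t.
have mg n : c * nrm t ^+ 2 <= margin X y (u t) n.
  rewrite marginE mulrC ler_pM ?exprn_ge0 ?(ltW n0) ?(ltW c0) ?(ltW (mc n))//.
  by rewrite ler_weXn2l// ltW.
have cn1 : 1 <= c * nrm t ^+ 2.
  move: n2; rewrite -[ltLHS]mulr1 ltr_pdivrMl// => /ltW/le_trans; apply.
  by rewrite ler_pM2l// expr2 ler_peMl// ltW.
have l1 : eta t * lossu X y (u t) * (2 * c ^+ 2 * nrm t ^+ 4) <= nrm t ^+ 2.
  apply: le_trans (step_margin t); rewrite lossuE// -mulrA ler_pM2l// mulr_suml.
  apply: ler_sum => n _; rewrite ler_wpM2l ?expR_ge0//.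
  have : (c * nrm t ^+ 2) ^+ 2 <= margin X y (u t) n ^+ 2.
    by rewrite lerXn2r ?nnegrE ?(le_trans _ (mg n)) ?(le_trans ler01 cn1).
  have : 0 <= margin X y (u t) n * (margin X y (u t) n - 1).
    by have := mg n => ?; rewrite mulr_ge0//; lra.
  by rewrite exprMn -exprM; lra.
have l2 : eta t * lossu X y (u t) * (2 * c ^+ 2 * nrm t) <= 1.
  rewrite -(ler_pM2r (exprn_gt0 2 n0)) mul1r; apply: le_trans l1.
  have n34 : nrm t ^+ 3 <= nrm t ^+ 4 by rewrite ler_weXn2l// ltW.
  have P0 : 0 <= eta t * lossu X y (u t) * (2 * c ^+ 2).
    apply: mulr_ge0; last by rewrite mulr_ge0 ?sqr_ge0.
    apply: mulr_ge0; [exact: ltW|rewrite lossuE//].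
    by apply: sumr_ge0 => n _; exact: expR_ge0.
  have := ler_wpM2l P0 n34; lra.
apply: (@le_trans _ _ (K * (eta t * lossu X y (u t)))).
  by rewrite /rate mulrCA ler_pM2l.
move: n3; rewrite ltr_pdivrMr ?mulr_gt0 ?exprn_gt0// => n3.
have c20 : 0 < 2 * c ^+ 2 * nrm t by rewrite !mulr_gt0// exprn_gt0.
rewrite -(ler_pM2r c20).
have := ler_wpM2l (ltW K0) l2; lra.
Unshelve. all: by end_near. Qed.

Lemma mode_step t d l j : L = 2%N -> l != j ->
  dftc (u t.+1 l) d = dftc (u t l) d +
    (rate t)%:C * dftc (resdir t) d * cj (dftc (u t j) d).
Proof.
move=> L2 lj; rewrite (dftc_gd L_gt0 (gd t)) (cfold_perm _ _ (perm_others2 lj)).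
have -> : others2 l j = [::].
  apply: size0nil; rewrite size_rem ?size_others ?L2// mem_others eq_sym.
  exact: lj.
rewrite dftc_cfold big_seq1.
have -> : residual X y (u t) = fun d => enorm (res t) * resdir t d.
  apply/funext => i; rewrite /resdir mulrC divfK// gt_eqF//.
  exact: res_norm_gt0.
by rewrite dftcZ /rate real_complexM; ring.
Qed.

(** The step condition is open: the midpoint [eta'] of [eta t] and [beta^-1] is also admissible,
    which makes the bound strict. Strictness keeps a nonzero imbalance nonzero. *)
Lemma rate_modulus_lt1 t d : L = 2%N -> rate t ^+ 2 * nsq (dftc (resdir t) d) < 1.
Proof.
move=> L2; pose k : 'I_L := Ordinal L_gt1.
have ik : i0 != k by [].
have o2 : others2 i0 k = [::].
  by apply: size0nil; rewrite size_rem ?size_others ?L2// mem_others.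
have [eta0 [r [beta [r0 [beta0 [eb lip]]]]]] := step t.
pose eta' := (eta t + beta^-1) / 2.
have step' : step_ok (lossu X y) (u t) eta'.
  by split; [|exists r, beta; do ?split=> //]; rewrite /eta'; lra.
have := step_dftc L_gt0 ik step' d; rewrite o2 /=.
have -> : cfold (u t) [::] (residual X y (u t)) = fun d => enorm (res t) * resdir t d.
  apply/funext => i; rewrite /resdir mulrC divfK// gt_eqF//.
  exact: res_norm_gt0.
rewrite dftcZ nsqM nsq_real.
have -> : rate t ^+ 2 * nsq (dftc (resdir t) d) =
    eta t ^+ 2 * (enorm (res t) ^+ 2 * nsq (dftc (resdir t) d)).
  by rewrite /rate; ring.
have : 0 <= enorm (res t) ^+ 2 * nsq (dftc (resdir t) d).
  by rewrite mulr_ge0 ?sqr_ge0 ?nsq_ge0.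
move: (enorm (res t) ^+ 2 * _) => Z Z0 h.
have [->|Zn] := eqVneq Z 0; first by rewrite mulr0.
have Zp : 0 < Z by rewrite lt_def Zn.
apply: lt_le_trans h; rewrite ltr_pM2r// ltr_sqr ?nnegrE ?(ltW eta0)//; rewrite /eta'; lra.
Qed.

Lemma zero_frequency_le lam k d : L = 2%N -> k != i0 -> 0 < lam ->
  (forall i d, ubar i d = lam * Gbar i d) ->
  nsq (dftc (u 0 i0) d) != nsq (dftc (u 0 k) d) ->
  modulus2 d = 0 -> lam ^+ 2 * nsq (dftc zbar d) <= 1.
Proof.
move=> L2 ki0 lam0 stat unb md; rewrite leNgt; apply/negP => gt1.
have i0k : i0 != k by rewrite eq_sym.
have [d0 md0] := exists_frequency.
have r0 : 0 < modulus2 d0 by rewrite lt_def md0 nsq_ge0.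
(* At a frequency present in the limit, stationarity with [L = 2] forces the modulus of
   [dftc zbar d0] to be exactly [lam^-1]. *)
have z0 : nsq (dftc zbar d0) = lam^-1 ^+ 2.
  have := congr1 (@nsq R) (dftc_stationary d0 stat).
  rewrite nsq_dftc_Pubar nsqM nsq_real L2 /= expr1 exprMn => e.
  have n0 : lam ^+ 2 * modulus2 d0 ^+ 2 != 0 by rewrite mulf_neq0 ?expf_neq0// gt_eqF.
  by apply: (mulfI n0); rewrite -e; field; rewrite gt_eqF.
pose rho := Num.sqrt (nsq (dftc zbar d)); pose rho0 := lam^-1.
have rho00 : 0 < rho0 by rewrite invr_gt0.
have rho0rho : rho0 < rho.
  rewrite -[rho0]ger0_norm ?(ltW rho00)// -sqrtr_sqr ltr_sqrt; last first.
    rewrite lt_def nsq_ge0 andbT; apply/eqP => z; move: gt1; rewrite z mulr0.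
    by rewrite ltNge ler01.
  by rewrite exprVn -[ltLHS]mulr1 ltr_pdivrMl ?exprn_gt0.
have rhop : 0 < rho by exact: lt_trans rho0rho.
have rho2 : nsq (dftc zbar d) = rho ^+ 2 by rewrite sqr_sqrtr ?nsq_ge0.
pose e : R[i] := (rho^-1)%:C * dftc zbar d.
have e1 : nsq e = 1 by rewrite nsqM nsq_real rho2 exprVn mulVf// expf_neq0// gt_eqF.
(* A rate strictly between the two moduli: eventually a lower bound for the growth at [d] and an
   upper bound for that at [d0]. *)
pose rho1 := (rho0 + rho) / 2.
have rho1p : 0 < rho1 by rewrite divr_gt0// addr_gt0.
have cq : cdot (dftc (resdir t) d) e @[t --> \oo] --> rho.
  have -> : rho = cdot (dftc zbar d) e.
    rewrite /e; transitivity (rho^-1 * nsq (dftc zbar d)); last first.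
      by case: (dftc zbar d) => a b; rewrite /cdot /nsq /=; ring.
    by rewrite rho2 expr2 mulKf// gt_eqF.
  have [h1 h2] := cvg_dft d (fun j => @cvg_resdir j).
  by case: e {e1} => a b; apply: cvgD; exact: cvgMr_tmp.
have cnq d' : nsq (dftc (resdir t) d') @[t --> \oo] --> nsq (dftc zbar d').
  by apply: cvg_nsq_dftc => j; exact: cvg_resdir.
have chq : rate t * nsq (dftc (resdir t) d) @[t --> \oo] --> (0 : R).
  by rewrite -(mul0r (nsq (dftc zbar d))); apply: cvgM => //; exact: rate_cvg0.
pose s t := Num.sqrt (nsq (dftc (resdir t) d0)).
have cs : s t @[t --> \oo] --> rho0.
  rewrite -[rho0]ger0_norm ?(ltW rho00)// -sqrtr_sqr -z0.
  exact: cvg_sqrt.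
have N1 : \forall t \near \oo,
    rho1 < cdot (dftc (resdir t) d) e - rate t * nsq (dftc (resdir t) d) / 2.
  have c1 : cdot (dftc (resdir t) d) e - rate t * nsq (dftc (resdir t) d) / 2
      @[t --> \oo] --> rho - 0 / 2.
    by apply: cvgB => //; exact: cvgMr_tmp.
  by apply: (cvgr_gt _ c1); rewrite /rho1; lra.
have N2 : \forall t \near \oo, 2 * s t + rate t * s t ^+ 2 < 2 * rho1.
  have c1 : 2 * s t + rate t * s t ^+ 2 @[t --> \oo] --> 2 * rho0 + 0 * rho0 ^+ 2.
    by apply: cvgD; [exact: cvgMl_tmp|apply: cvgM; [exact: rate_cvg0|exact: cvg_sqr]].
  by apply: (cvgr_lt _ c1); rewrite /rho1; lra.
have N3 : \forall t \near \oo, rate t * nsq (dftc (resdir t) d) < rho1 / 2.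
  by apply: (cvgr_lt _ chq); rewrite divr_gt0.
have N4 : \forall t \near \oo, rate t < rho1^-1.
  by apply: (cvgr_lt _ rate_cvg0); rewrite invr_gt0.
pose En d' t := nsq (dftc (u t i0) d') + nsq (dftc (u t k) d').
pose Edir d' t := nsq (dftc (dir t i0) d') + nsq (dftc (dir t k) d').
have EnE d' t : En d' t = nrm t ^+ 2 * Edir d' t by rewrite /En !nsq_dftc_u -mulrDr.
have cE d' : Edir d' t @[t --> \oo] --> 2 * modulus2 d'.
  rewrite mulr_natl mulr2n {2}/modulus2 (balanced i0 k).
  by apply: cvgD; apply: cvg_nsq_dftc => j; exact: u_dir.
have N5 : \forall t \near \oo, modulus2 d0 < Edir d0 t.
  by apply: (cvgr_gt _ (cE d0)); lra.
have N6 := nrm_gt 0.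
(* From time [T] on, [N1] to [N4] give the step inequalities for [p], [E0], [q] and the bound on the
   rate, while [N5] and [N6] make [E0] positive. *)
have [T _ hT] := filterI N1 (filterI N2 (filterI N3 (filterI N4 (filterI N5 N6)))).
have sh t : (T <= T + t)%N by exact: leq_addr.
pose p t := cdot (dftc (u t i0) d * dftc (u t k) d) e.
pose q t := `|nsq (dftc (u t i0) d) - nsq (dftc (u t k) d)|.
have stp d' t := mode_step t d' L2 i0k.
have stp' d' t := mode_step t d' L2 ki0.
have qS t : q t.+1 = q t * (1 - rate t ^+ 2 * nsq (dftc (resdir t) d)).
  rewrite /q stp stp' mode_difference_step normrM; congr (_ * _).
  by rewrite ger0_norm// subr_ge0 ltW// rate_modulus_lt1.
have q_gt0 t : 0 < q t.
  elim: t => [|t IH]; first by rewrite normr_gt0 subr_eq0.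
  by rewrite qS mulr_gt0// subr_gt0 rate_modulus_lt1.
have [||||||||||K [T' [K0 hK]]] := @p_dominates R (fun t => p (T + t)%N)
  (fun t => En d (T + t)%N) (fun t => q (T + t)%N) (fun t => En d0 (T + t)%N)
  (fun t => rate (T + t)%N) rho1 rho1p.
- by move=> t; exact: rate_ge0.
- move=> t; have [_ [_ [_ [h _]]]] := hT _ (sh t).
  by rewrite mulrC -ler_pdivlMr// mul1r ltW.
- by move=> t; exact: q_gt0.
- by move=> t; exact: mode_cdot_le.
- move=> t; rewrite /q /En; apply: le_trans (ler_normB _ _) _.
  by rewrite !ger0_norm ?nsq_ge0.
- move=> t; have [h _] := hT _ (sh t); rewrite addnS /p stp stp'.
  apply: le_trans (mode_product_step _ _ _ _ e1).
  rewrite lerD2l; apply: ler_wpM2r; first by rewrite addr_ge0 ?nsq_ge0.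
  by rewrite mulrC; apply: ler_wpM2l; [exact: rate_ge0|exact: ltW].
- move=> t; have [_ [_ [h _]]] := hT _ (sh t); rewrite addnS qS.
  apply: ler_wpM2l; first exact: ltW.
  rewrite lerD2l lerN2 expr2 -mulrA mulrC; apply: ler_wpM2r; first exact: rate_ge0.
  exact: ltW.
- move=> t; have [_ [_ [_ [_ [h n0]]]]] := hT _ (sh t).
  by rewrite EnE mulr_gt0 ?exprn_gt0// (lt_trans r0).
- move=> t; have [_ [h _]] := hT _ (sh t); rewrite addnS /En stp stp'.
  apply: le_trans (mode_energy_step _ _ (rate_ge0 _) (s := s (T + t)%N) _ _) _.
  + exact: sqrtr_ge0.
  + by rewrite sqr_sqrtr ?nsq_ge0.
  apply: ler_wpM2l; first by rewrite addr_ge0 ?nsq_ge0.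
  by rewrite lerD2l mulrC; apply: ler_wpM2r; [exact: rate_ge0|exact: ltW].
- move=> B; have [T2 _ hT2] := nrm_gt (Num.max 1 (B / modulus2 d0)).
  exists T2; have := hT2 (T + T2)%N (leq_addl _ _); rewrite /= gt_max => /andP[n1 n2].
  have [_ [_ [_ [_ [h n0]]]]] := hT _ (sh T2).
  rewrite EnE; move: n2; rewrite ltr_pdivrMr// => /lt_le_trans; apply.
  rewrite ler_pM ?nrm_ge0 ?(ltW r0) ?(ltW h)//.
  by rewrite expr2 ler_peMl ?nrm_ge0// ltW.
(* Dividing [K * En d0 t <= p t <= En d t / 2] by [nrm t ^+ 2] and passing to the limit opposes a
   positive energy at [d0] to a zero energy at [d]. *)
have : 2 * K * (2 * modulus2 d0) <= 2 * modulus2 d.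
  apply: (@ler_cvg_to _ \oo _ R (fun t => 2 * K * Edir d0 t) (Edir d)) => //.
    by apply: cvgMl_tmp; exact: cE.
  near=> t.
  have n0 : 0 < nrm t by near: t; exact: nrm_gt.
  have tT : (T + T' <= t)%N by near: t; exact: nbhs_infty_ge.
  have := hK (t - T)%N; rewrite leq_subRL ?(leq_trans (leq_addr _ _) tT)// tT => /(_ isT).
  rewrite subnKC ?(leq_trans (leq_addr _ _) tT)// => h.
  rewrite -(ler_pM2l (exprn_gt0 2 n0)) -EnE mulrCA -EnE.
  have : 2 * `|p t| <= En d t by exact: mode_cdot_le.
  have := ler_norm (p t); lra.
rewrite md mulr0 leNgt => /negP; apply.
by rewrite !mulr_gt0.
Unshelve. all: by end_near. Qed.

End Dynamics.

(** * First order stationarity in the Fourier domain *)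

Section Stationarity.
Variables (R : realType) (D' L N : nat).
Notation D := D'.+1.
Notation p := (2 / L%:R : R).

Lemma dft_lincomb (c : 'I_N -> R) (X : 'I_N -> 'I_D -> R) d :
  dft (fun i => \sum_(n < N) c n * X n i) d =
  (\sum_(n < N) c n * (dft (X n) d).1, \sum_(n < N) c n * (dft (X n) d).2).
Proof.
have lin (v : 'I_D -> R) : \sum_p (\sum_(n < N) c n * X n p) * v p =
    \sum_(n < N) c n * \sum_p X n p * v p.
  under eq_bigr do rewrite mulr_suml.
  rewrite exchange_big; apply: eq_bigr => n _ /=.
  by rewrite mulr_sumr; apply: eq_bigr => j _; rewrite mulrA.
rewrite /dft /=; congr pair.
  rewrite lin mulr_sumr; apply: eq_bigr => n _; exact: mulrCA.
rewrite lin mulr_sumr -sumrN; apply: eq_bigr => n _.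
by rewrite mulrN mulrCA.
Qed.

Lemma dftZ (c : R) (w : 'I_D -> R) d :
  dft (fun i => c * w i) d = (c * (dft w d).1, c * (dft w d).2).
Proof.
by have := dftcZ c w d; rewrite /dftc; case: (dft _ d) => a b [-> ->]; rewrite /= !mul0r subr0 addr0.
Qed.

Lemma cabs_dft (w : 'I_D -> R) d : cabs (dft w d) = Num.sqrt (nsq (dftc w d)).
Proof. by []. Qed.

Lemma cabsZ (c : R) (z : R * R) : 0 <= c -> cabs (c * z.1, c * z.2) = c * cabs z.
Proof.
move=> c0; rewrite /cabs /= !exprMn -mulrDr sqrtrM ?sqr_ge0//.
by rewrite sqrtr_sqr ger0_norm.
Qed.

(* [|P| = r^(L/2)], so that [|P|^(p-2) = r^(1-L)] with [p = 2/L]. *)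
Lemma modulus_power (r m : R) : (0 < L)%N -> 0 < r -> 0 < m ->
  let a := Num.sqrt (r ^+ L) in
  a^-1 * r ^+ L.-1 * (m^-1 * a) `^ (p - 1) = m `^ (1 - p).
Proof.
move=> L0 r0 m0 a.
have a0 : 0 < a by rewrite sqrtr_gt0 exprn_gt0.
have LR : L%:R != 0 :> R by rewrite pnatr_eq0 -lt0n.
have aE : a = r `^ (L%:R / 2).
  by rewrite /a -powR12_sqrt ?exprn_ge0 ?ltW// -powR_mulrn ?ltW// -powRrM.
rewrite powRM ?invr_ge0 ?ltW// -[m^-1]powR_inv1 ?ltW// -powRrM.
rewrite (_ : -1 * (p - 1) = 1 - p); last by ring.
rewrite [X in _ * X]mulrC mulrA -[RHS]mul1r; congr (_ * _).
rewrite aE -powRN -powR_mulrn ?ltW// -!powRrM -!powRD ?(gt_eqF r0) ?implybT//.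
rewrite (_ : _ + _ = 0) ?powRr0//.
by rewrite -subn1 natrB//; field.
Qed.

(** Dividing [P] by its smallest margin [m] makes the constraints hold with equality exactly at the
    samples of least margin, the only ones where [alpha] may be nonzero. *)
Lemma fosp_of_stationary (X : 'I_N -> 'I_D -> R) (y : 'I_N -> R)
    (P zb : 'I_D -> R) (r : 'I_D -> R) (lam : R) (mu alpha : 'I_N -> R) :
  (0 < L)%N -> (0 < N)%N -> 0 < lam ->
  (forall n, mu n = y n * dotp (X n) P) -> (forall n, 0 < mu n) ->
  (forall n, 0 <= alpha n) -> (forall n k, mu k < mu n -> alpha n = 0) ->
  (forall d, zb d = \sum_(n < N) alpha n * y n * X n d) ->
  (forall d, 0 <= r d) -> (forall d, nsq (dftc P d) = r d ^+ L) ->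
  (forall d, dftc P d = (lam * r d ^+ L.-1)%:C * dftc zb d) ->
  (L = 2%N -> forall d, r d = 0 -> lam ^+ 2 * nsq (dftc zb d) <= 1) ->
  exists (m : R) (w0 : 'I_D -> R),
    0 < m /\ fosp L X y w0 /\ P = (fun d => m * w0 d).
Proof.
move=> L0 N0 lam0 muE mu0 alpha0 compl zbE r0 PL stat zero.
have [k _ kmin] := @Order.TotalTheory.arg_minP _ _ 'I_N (Ordinal N0) xpredT mu isT.
pose m := mu k; have m0 : 0 < m by exact: mu0.
pose w0 d := m^-1 * P d.
(* This rescaling of the multipliers absorbs the constant left by [modulus_power] in the
   subdifferential of the power [p]; for [L = 2] it reduces to [lam]. *)
pose c := p * m `^ (1 - p) * lam.
have p0 : 0 < p by rewrite divr_gt0 ?ltr0n.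
have c0 : 0 < c by do 2![apply: mulr_gt0 => //]; exact: powR_gt0.
have margin0 n : y n * dotp (X n) w0 = mu n / m.
  by rewrite dotpZr muE mulrCA mulrC.
exists m, w0; split=> //; split; last first.
  by apply/funext => d; rewrite /w0 mulVKf// gt_eqF.
split=> [n|]; first by rewrite margin0 ler_pdivlMr// mul1r kmin.
exists (fun n => c * alpha n); split; first by move=> n; rewrite mulr_ge0// ltW.
split=> [n|].
  by rewrite margin0 ltr_pdivlMr// mul1r => /compl ->; rewrite mulr0.
have zE d : (\sum_(n < N) c * alpha n * y n * (dft (X n) d).1,
             \sum_(n < N) c * alpha n * y n * (dft (X n) d).2) =
            (c * (dft zb d).1, c * (dft zb d).2).
  rewrite -dft_lincomb -dftZ; congr dft; apply/funext => i.
  by rewrite zbE mulr_sumr; apply: eq_bigr => n _; rewrite !mulrA.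
have cabs0 d : cabs (dft w0 d) = m^-1 * Num.sqrt (r d ^+ L).
  by rewrite /w0 dftZ cabsZ ?invr_ge0 ?ltW// cabs_dft PL.
have stat2 d : dft P d = (lam * r d ^+ L.-1 * (dft zb d).1,
                          lam * r d ^+ L.-1 * (dft zb d).2).
  have := stat d; rewrite /dftc; case: (dft P d) => a b [-> ->].
  by rewrite /= !mul0r subr0 addr0.
have rpos d : dft w0 d != (0, 0) -> 0 < r d.
  move=> w0d; rewrite lt_def r0 andbT; apply: contra w0d => /eqP rd.
  have : cabs (dft w0 d) = 0 by rewrite cabs0 rd expr0n gtn_eqF// sqrtr0 mulr0.
  move/eqP; rewrite sqrtr_eq0 => h.
  have := sqr_ge0 (dft w0 d).1; have := sqr_ge0 (dft w0 d).2 => h1 h2.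
  case: (dft w0 d) h h1 h2 => x1 x2 /= h h1 h2.
  have /eqP : x1 ^+ 2 = 0 by lra.
  have /eqP : x2 ^+ 2 = 0 by lra.
  by rewrite !sqrf_eq0 => /eqP -> /eqP ->.
have gen d : dft w0 d != (0, 0) ->
    (c * (dft zb d).1, c * (dft zb d).2) =
    (p * (phase (dft w0 d)).1 * cabs (dft w0 d) `^ (p - 1),
     p * (phase (dft w0 d)).2 * cabs (dft w0 d) `^ (p - 1)).
  move=> w0d; rewrite /phase (negbTE w0d) cabs0.
  have rd := rpos d w0d; have E := modulus_power L0 rd m0; cbv zeta in E.
  set a := Num.sqrt (r d ^+ L) in E *.
  have a0 : a != 0 by rewrite gt_eqF// sqrtr_gt0 exprn_gt0.
  rewrite /c -E /w0 dftZ stat2.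
  by move: (dft zb d) => [z1 z2] /=; congr pair; field; rewrite a0 gt_eqF// pnatr_eq0 -lt0n.
rewrite /in_clarke; cbv beta zeta.
case: ifP => [/eqP L2|_] d; rewrite zE; last exact: gen.
have p1 : p = 1 by rewrite L2 divff.
have c1 : c = lam by rewrite /c p1 subrr powRr0 !mul1r.
have ph : dft w0 d != (0, 0) -> (c * (dft zb d).1, c * (dft zb d).2) = phase (dft w0 d).
  move=> w0d; rewrite gen// p1 subrr powRr0 !mulr1 !mul1r.
  by case: phase.
split=> //; have [w0d|/ph ->] := eqVneq (dft w0 d) (0, 0).
  rewrite cabsZ ?(ltW c0)// c1 cabs_dft -(ger0_norm (ltW lam0)) -sqrtr_sqr.
  rewrite -sqrtrM ?sqr_ge0// -sqrtr1 ler_sqrt//; apply: zero => //.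
  move/(congr1 (@cabs R)): w0d; rewrite cabs0 /cabs /= expr0n addr0 sqrtr0 => /eqP.
  rewrite mulf_eq0 invr_eq0 gt_eqF//= sqrtr_eq0 => h.
  have /eqP : r d ^+ L = 0 by apply/eqP; rewrite eq_le h exprn_ge0.
  by rewrite expf_eq0 => /andP[_ /eqP].
rewrite /phase; case: ifP => w0d.
  by rewrite /cabs /= expr1n expr0n addr0 sqrtr1.
rewrite {1}/cabs /= !expr_div_n -mulrDl.
have -> : (dft w0 d).1 ^+ 2 + (dft w0 d).2 ^+ 2 = cabs (dft w0 d) ^+ 2.
  by rewrite sqr_sqrtr// addr_ge0 ?sqr_ge0.
have [->|h] := eqVneq (cabs (dft w0 d) ^+ 2) 0; first by rewrite mul0r sqrtr0.
by rewrite divff// sqrtr1.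
Qed.

End Stationarity.

Local Close Scope complex_scope.

Theorem mainTheorem3 (R : realType) (L D N : nat) :
  (2 <= L)%N -> (1 <= D)%N -> (1 <= N)%N ->
  forall y : 'I_N -> R, (forall n, y n = 1 \/ y n = -1) ->
  exists Zdata : set ('I_N -> 'I_D -> R), null_set2 Zdata /\
  forall X : 'I_N -> 'I_D -> R, ~ Zdata X -> lin_separable X y ->
  exists Zinit : set ('I_L -> 'I_D -> R), null_set2 Zinit /\
  forall (u : nat -> 'I_L -> 'I_D -> R) (eta : nat -> R),
    ~ Zinit (u 0%N) ->
    (forall t, step_ok (lossu X y) (u t) (eta t)) ->
    (forall t l d, u t.+1 l d = u t l d - eta t * gradu (lossu X y) (u t) l d) ->
    let w := fun t => Pconv (u t) in
    (* (a) *) (fun t => lossu X y (u t)) @ \oo --> 0 ->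
    (* (b) *) dir_cvg_u u ->
    forall wbar : 'I_D -> R,
      cvg_to_vec (fun t d => w t d / enorm (w t)) wbar ->
      (forall n, 0 < y n * dotp (X n) wbar) ->
    (* (c) *) (forall d, exists z : R * R,
                 (fun t => (phase (dft (w t) d)).1) @ \oo --> z.1 /\
                 (fun t => (phase (dft (w t) d)).2) @ \oo --> z.2) ->
    (* (d) *) dir_cvg_w (fun t => gradw (lossw X y) (w t)) ->
    exists (gamma : R) (w0 : 'I_D -> R),
      0 < gamma /\ fosp L X y w0 /\ wbar = (fun d => gamma * w0 d).
Proof.
move=> L2 D1 N1 y _; case: D D1 => [//|D'] _.
pose l0 : 'I_L := Ordinal (ltnW L2); pose l1 : 'I_L := Ordinal L2.
have l10 : l1 != l0 by [].
exists set0; split; first exact: (null_set0 (Ordinal N1, ord0)).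
move=> X _ _.
(* Balance at some frequency is excluded for two layers only; the set is empty for larger [L]. *)
exists [set u | L = 2%N /\ exists d, nsq (dftc (u l0) d) = nsq (dftc (u l1) d)].
split.
  have [L2E|Ln] := eqVneq L 2%N; last first.
    rewrite (_ : [set _ | _] = set0); first exact: (null_set0 (l0, ord0)).
    by apply/seteqP; split=> u //= -[] /eqP; rewrite (negbTE Ln).
  rewrite (_ : [set _ | _] = [set u : 'I_L -> 'I_D'.+1 -> R |
      exists d, nsq (dftc (u l0) d) = nsq (dftc (u l1) d)]).
    exact: null_set_balanced.
  by apply/seteqP; split=> u /=; [case|].
move=> u eta nZ step gd w loss0 [ubar ulim] wbar wlim wpos _ [zl zlim].
have unb : L = 2%N -> forall d, nsq (dftc (u 0 l0) d) != nsq (dftc (u 0 l1) d).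
  by move=> L2E d; apply/eqP => e; apply: nZ; split=> //; exists d.
have [lam lam0 stat] := exists_stationary L2 N1 step gd loss0 ulim wlim wpos zlim.
have [alpha [alpha0 compl zE]] := exists_multipliers L2 N1 step gd loss0 ulim wlim wpos zlim.
have kap := kappa_gt0 L2 N1 step gd loss0 ulim.
have [] := @fosp_of_stationary R D' L N X y (Pconv ubar) (zbar zl) (modulus2 L2 ubar) lam
  (mu X y ubar) alpha (ltnW L2) N1 lam0.
- by move=> n; rewrite dotp_Pconv// ltnW.
- exact: (mu_gt0 L2 N1 step gd loss0 ulim wlim wpos).
- exact: alpha0.
- exact: compl.
- exact: zE.
- by move=> d; exact: nsq_ge0.
- exact: (nsq_dftc_Pubar L2 N1 step gd loss0 ulim).
- move=> d.
  exact: (dftc_stationary L2 N1 step gd loss0 ulim).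
- move=> L2E d md.
  exact: (zero_frequency_le N1 step gd loss0 ulim wlim wpos zlim L2E l10 lam0 stat (unb L2E d)).
(* [Pconv ubar] is [m] times [w0] and [kappa] times [wbar], whence the quotient. *)
move=> m [w0 [m0 [fw PE]]]; exists (m / kappa ubar), w0; split; first by rewrite divr_gt0.
split=> //; apply/funext => d.
have := Pubar_wbar L2 N1 step gd loss0 ulim wlim d; rewrite PE => e.
by rewrite mulrAC e mulrC mulKf// gt_eqF.
Qed.
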